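(* Let $m^f_1,m^f_2,m^f_3,\overline{m}^f_1,\overline{m}^f_2,\overline{m}^f_3$ be the six fibre lines of the $\mathbf{Nil}$ Pappus cylinder configuration described in the context. Then there exists a unique equivalence class of $\mathbf{Nil}$ geodesics (up to $\mathbf{Nil}$ congruence) that intersects the fibres $m^f_1,m^f_2,m^f_3,\overline{m}^f_1,\overline{m}^f_2,\overline{m}^f_3$; that is, exactly one equivalence class contains a geodesic that intersects all six of these fibre lines.
   Context: $\mathbf{Nil}$ geometry (Heisenberg model): the space $\mathbf{R}^3$ with coordinates $(x,y,z)$ and Riemannian metric $ds^2=dx^2+dy^2+(dz-x\,dy)^2$; it is invariant under the $\mathbf{Nil}$ translations $(a,b,c)\mapsto(x+a,\,y+b,\,z+bx+c)$ with parameters $x,y,z\in\mathbf{R}$. $\mathbf{Nil}$ isometries (congruences) are the isometries of this metric; $\mathbf{Nil}$ geodesics are the complete geodesic curves of this metric. Two geodesic curves are equivalent if some $\mathbf{Nil}$ isometry maps one onto the other. The base plane is the plane $z=0$; fibre lines (fibres) are the straight lines parallel to the $z$-axis. For $r>0$, $\mathcal{C}^i(r)$ is the surface ruled by the fibre lines passing through the points of the Euclidean circle of radius $r$ in the base plane centred at the origin. An infinite circular cylinder is an image of some $\mathcal{C}^i(r)$ under a $\mathbf{Nil}$ isometry; in addition, the Euclidean plane formed by the fibre lines through the points of a Euclidean straight line of the base plane is also called an infinite circular cylinder (of infinite radius). For three distinct points $X,Y,Z$ of the base plane, $\mathcal{C}^i_{XYZ}$ denotes the infinite circular cylinder passing through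 them, i.e. the union of the fibre lines through the points of the Euclidean circle (or straight line, if they are collinear) through $X,Y,Z$; $\mathcal{C}^i_{XYZW}$ denotes an infinite circular cylinder through the four points $X,Y,Z,W$. Pappus cylinder configuration. Let $A_1,A_2,A_3,B_1,B_2,B_3$ be six points of the base plane, and let $\overline{A}_1$ be the base-plane point of a fibre line on $\mathcal{C}^i_{A_1A_2A_3}$. Let $\overline{B}_2$, $\overline{A}_3$, $\overline{B}_1$, $\overline{A}_2$, $\overline{B}_3$ be, successively, the base-plane points of the following fibre lines: the common fibre line of $\mathcal{C}^i_{A_1B_2\overline{A}_1}$ and $\mathcal{C}^i_{B_1B_2B_3}$ other than the one through $B_2$; the common fibre line of $\mathcal{C}^i_{B_2A_3\overline{B}_2}$ and $\mathcal{C}^i_{A_1A_2A_3}$ other than the one through $A_3$; the common fibre line of $\mathcal{C}^i_{A_3B_1\overline{A}_3}$ and $\mathcal{C}^i_{B_1B_2B_3}$ other than the one through $B_1$; the common fibre line of $\mathcal{C}^i_{B_1A_2\overline{B}_1}$ and $\mathcal{C}^i_{A_1A_2A_3}$ other than the one through $A_2$; the common fibre line of $\mathcal{C}^i_{A_2B_3\overline{A}_2}$ and $\mathcal{C}^i_{B_1B_2B_3}$ other than the one through $B_3$. (It is a theorem that $\overline{A}_1$ then lies on $\mathcal{C}^i_{B_3A_1\overline{B}_3}$.) Let $m^f_1,\overline{m}^f_1$ be the two fibre lines in which $\mathcal{C}^i_{A_1B_2\overline{A}_1\overline{B}_2}$ and $\mathcal{C}^i_{A_2B_1\overline{A}_2\overline{B}_1}$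 meet, $m^f_2,\overline{m}^f_2$ the two fibre lines in which $\mathcal{C}^i_{A_1B_3\overline{A}_1\overline{B}_3}$ and $\mathcal{C}^i_{A_3B_1\overline{A}_3\overline{B}_1}$ meet, and $m^f_3,\overline{m}^f_3$ the two fibre lines in which $\mathcal{C}^i_{A_3B_2\overline{A}_3\overline{B}_2}$ and $\mathcal{C}^i_{A_2B_3\overline{A}_2\overline{B}_3}$ meet. It is understood that every object named in the construction is well defined: whenever $\mathcal{C}^i_{XYZ}$ is written, $X,Y,Z$ are distinct; whenever two cylinders are intersected, they are different; and the ''other'' intersection fibre lines, and the pairs $m^f_i,\overline{m}^f_i$ of two distinct fibre lines, exist. *)

(* Defs.v *)
From HB Require Import structures.
From mathcomp Require Import all_boot all_order all_algebra.
From mathcomp Require Import all_classical all_reals all_analysis.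

Set Implicit Arguments.
Unset Strict Implicit.
Unset Printing Implicit Defensive.

Import Order.TTheory GRing.Theory Num.Theory.
Import numFieldNormedType.Exports.

Local Open Scope classical_set_scope.
Local Open Scope ring_scope.

(** * Riemannian metrics on R^3 *)

Section Riemannian.
Variable R : realType.
Local Notation space := 'rV[R]_3.

Definition basis_vec (i : 'I_3) : space := delta_mx 0 i.

Definition partial (W : normedModType R) (i : 'I_3) (f : space -> W)
  : space -> W := fun p => 'D_(basis_vec i) f p.

Fixpoint Ck (W : normedModType R) (n : nat) (f : space -> W) : Prop :=
  if n is k.+1 then
    (forall p, differentiable f p) /\ (forall i, Ck k (partial i f))
  else continuous f.

Definition smooth (W : normedModType R) (f : space -> W) : Prop :=
  forall n, Ck n f.

(** [g p u v] is the inner product of the tangent vectors [u], [v] at [p]. *)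
Definition metric := space -> space -> space -> R.

Definition gram (g : metric) (p : space) : 'M[R]_3 :=
  \matrix_(i, j) g p (basis_vec i) (basis_vec j).

(** Christoffel symbol of the second kind, upper index [k]:
    1/2 sum_l g^{kl} (d_i g_{jl} + d_j g_{il} - d_l g_{ij}). *)
Definition christoffel (g : metric) (k i j : 'I_3) (p : space) : R :=
  2^-1 * \sum_(l < 3) invmx (gram g p) k l *
    (partial i (fun q => gram g q j l : R) p
     + partial j (fun q => gram g q i l : R) p
     - partial l (fun q => gram g q i j : R) p).

(** An affinely parametrized geodesic defined for all times (hence complete);
    The condition on [derive1 c t] excludes constant curves. *)
Definition geodesic_param (g : metric) (c : R -> space) : Prop :=
  forall t : R,
    [/\ derivable c t 1, derivable (derive1 c) t 1, derive1 c t != 0 &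
        forall k : 'I_3,
          derive1 (derive1 c) t 0 k
          + \sum_(i < 3) \sum_(j < 3)
              christoffel g k i j (c t) * derive1 c t 0 i * derive1 c t 0 j = 0].

(** A complete geodesic curve, as a set of points. *)
Definition geodesic (g : metric) (G : set space) : Prop :=
  exists2 c : R -> space, geodesic_param g c & G = range c.

Definition preserves_metric (g : metric) (phi : space -> space) : Prop :=
  forall p u v : space, g (phi p) ('d phi p u) ('d phi p v) = g p u v.

Definition isometry (g : metric) (phi : space -> space) : Prop :=
  [/\ smooth phi,
      exists psi : space -> space,
        [/\ smooth psi, cancel phi psi & cancel psi phi]
    & preserves_metric g phi].

Definition equivalent (g : metric) (G G' : set space) : Prop :=
  exists2 phi : space -> space, isometry g phi & phi @` G = G'.

Definition geodesic_class (g : metric) (C : set (set space)) : Prop :=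
  exists2 G, geodesic g G & C = [set G' | geodesic g G' /\ equivalent g G G'].

End Riemannian.

(** * Nil geometry in the Heisenberg model *)

Section Nil.
Variable R : realType.
Local Notation space := 'rV[R]_3.

Definition xc (p : space) : R := p 0 0.
Definition yc (p : space) : R := p 0 1.
Definition zc (p : space) : R := p 0 2.

(** ds^2 = dx^2 + dy^2 + (dz - x dy)^2, polarized. *)
Definition nil_metric : metric R := fun p u v =>
  xc u * xc v + yc u * yc v
  + (zc u - xc p * yc u) * (zc v - xc p * yc v).

Definition base_plane : set space := [set p | zc p = 0].

Definition fibre (p : space) : set space :=
  [set q | xc q = xc p /\ yc q = yc p].

Definition fibre_line (m : set space) : Prop := exists p, m = fibre p.

Definition circle (c : space) (r : R) : set space :=
  base_plane `&`
  [set p | (xc p - xc c) ^+ 2 + (yc p - yc c) ^+ 2 = r ^+ 2].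

Definition line (a b d : R) : set space :=
  base_plane `&` [set p | a * xc p + b * yc p = d].

Definition circle_or_line (S : set space) : Prop :=
  (exists c r, 0 < r /\ S = circle c r) \/
  (exists a b d, (a != 0 \/ b != 0) /\ S = line a b d).

(** For distinct [X], [Y], [Z] in the base plane there is exactly one [S] in
    the outer union. *)
Definition cylinder (X Y Z : space) : set space :=
  \bigcup_(S in [set S | circle_or_line S /\ [/\ S X, S Y & S Z]])
    \bigcup_(p in S) fibre p.

Definition distinct3 (X Y Z : space) : Prop := [/\ X <> Y, Y <> Z & X <> Z].

(** [Y] is the base point of the common fibre line of [K] and [K'] other than
    the one through [X]. *)
Definition other_common_fibre (K K' : set space) (X Y : space) : Prop :=
  [/\ K <> K', base_plane Y, Y <> X & fibre Y `<=` K `&` K'].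

Definition meet_in_two_fibres (K K' m m' : set space) : Prop :=
  [/\ K <> K', fibre_line m, fibre_line m', m <> m' & K `&` K' = m `|` m'].

(** [A1'] is the point written A_1 with an overbar, and similarly for the other
    primed points and fibre lines.  A cylinder through four points
    A_i, B_j, A_i', B_j' is given by the three of them that determine it in the
    chain; it contains the fourth by construction, except that A1' lies on
    [cylinder B3 A1 B3'] by the closing theorem, which is not assumed. *)
Record pappus_configuration
    (A1 A2 A3 B1 B2 B3 A1' A2' A3' B1' B2' B3' : space)
    (m1 m2 m3 m1' m2' m3' : set space) : Prop := {
  pappus_A_base : [/\ base_plane A1, base_plane A2 & base_plane A3];
  pappus_B_base : [/\ base_plane B1, base_plane B2 & base_plane B3];
  pappus_A : distinct3 A1 A2 A3;
  pappus_B : distinct3 B1 B2 B3;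
  pappus_A1'_base : base_plane A1';
  pappus_A1' : fibre A1' `<=` cylinder A1 A2 A3;
  pappus_K1 : distinct3 A1 B2 A1';
  pappus_B2' :
    other_common_fibre (cylinder A1 B2 A1') (cylinder B1 B2 B3) B2 B2';
  pappus_K2 : distinct3 B2 A3 B2';
  pappus_A3' :
    other_common_fibre (cylinder B2 A3 B2') (cylinder A1 A2 A3) A3 A3';
  pappus_K3 : distinct3 A3 B1 A3';
  pappus_B1' :
    other_common_fibre (cylinder A3 B1 A3') (cylinder B1 B2 B3) B1 B1';
  pappus_K4 : distinct3 B1 A2 B1';
  pappus_A2' :
    other_common_fibre (cylinder B1 A2 B1') (cylinder A1 A2 A3) A2 A2';
  pappus_K5 : distinct3 A2 B3 A2';
  pappus_B3' :
    other_common_fibre (cylinder A2 B3 A2') (cylinder B1 B2 B3) B3 B3';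
  pappus_K6 : distinct3 B3 A1 B3';
  pappus_m1 :
    meet_in_two_fibres (cylinder A1 B2 A1') (cylinder B1 A2 B1') m1 m1';
  pappus_m2 :
    meet_in_two_fibres (cylinder B3 A1 B3') (cylinder A3 B1 A3') m2 m2';
  pappus_m3 :
    meet_in_two_fibres (cylinder B2 A3 B2') (cylinder A2 B3 A2') m3 m3'
}.

Definition intersects (G m : set space) : Prop := G `&` m !=set0.

End Nil.

(* Main.v *)
Require Import Defs.
From HB Require Import structures.
From mathcomp Require Import all_boot all_order all_algebra.
From mathcomp Require Import all_classical all_reals all_analysis.
From mathcomp Require Import ring lra.
Set Implicit Arguments.
Unset Strict Implicit.
Unset Printing Implicit Defensive.
Import Order.TTheory GRing.Theory Num.Theory.
Import numFieldNormedType.Exports.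
Local Open Scope classical_set_scope.
Local Open Scope ring_scope.

(**
Every circle or line of the base plane is the zero set of a cycle, a function
[a (x^2 + y^2) + b x + c y + d], and two cycles with three common zeros are
proportional.  Writing [A], [B], [f1], ..., [f6] for the cycles of the
configuration, consecutive [f_i] differ, up to scaling, by multiples of [A] or
[B] alternately.  A relation among the coefficients coming from the closing
point then yields a nonzero cycle lying in the three pencils spanned by
[f1, f4], by [f3, f6] and by [f2, f5], so the six intersection points lie on one
circle or line.

The geodesics of Nil other than fibres project to circles and lines of the base
plane, and each circle or line lifts to a geodesic that is unique up to vertical
translation.  As the six points contain three distinct ones, every geodesic
meeting the six fibres is a vertical translate of the one over their circle or
line.
*)

Section Cycles.
Variable R : realType.
Local Notation plane := (R * R)%type.
Implicit Types (f g h : plane -> R) (p q P Q S : plane).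

Definition cyc (a b c d : R) (p : plane) : R :=
  a * (p.1 ^+ 2 + p.2 ^+ 2) + b * p.1 + c * p.2 + d.

Definition cycle f : Prop := exists a b c d, f =1 cyc a b c d.

Definition proportional f g : Prop := forall p q, f p * g q = f q * g p.

Lemma cycle_lin (s t : R) f g : cycle f -> cycle g ->
  cycle (fun p => s * f p + t * g p).
Proof.
move=> [a [b [c [d fE]]]] [a' [b' [c' [d' gE]]]].
exists (s * a + t * a'), (s * b + t * b'), (s * c + t * c'), (s * d + t * d').
by move=> p; rewrite fE gE /cyc; ring.
Qed.

Lemma plane_neq P Q : P <> Q -> (P.1 - Q.1 != 0) || (P.2 - Q.2 != 0).
Proof.
case: P Q => [x y] [x' y'] /= neq; rewrite !subr_eq0 -negb_and.
by apply/negP => /andP[/eqP ex /eqP ey]; case: neq; rewrite ex ey.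
Qed.

Lemma orthogonal_proportional (u v b c b' c' : R) : (u != 0) || (v != 0) ->
  b * u + c * v = 0 -> b' * u + c' * v = 0 -> b * c' = b' * c.
Proof.
move=> nz e1 e2.
have eu : u * (b * c' - b' * c) = 0.
  transitivity (c' * (b * u + c * v) - c * (b' * u + c' * v)); first by ring.
  by rewrite e1 e2; ring.
have ev : v * (b * c' - b' * c) = 0.
  transitivity (b * (b' * u + c' * v) - b' * (b * u + c * v)); first by ring.
  by rewrite e1 e2; ring.
apply/eqP; rewrite -subr_eq0; case/orP: nz => nz.
  by move/eqP: eu; rewrite mulf_eq0 (negPf nz).
by move/eqP: ev; rewrite mulf_eq0 (negPf nz).
Qed.

Lemma cyc_collinear a b c d B C D P Q S : P <> Q -> Q <> S -> P <> S ->
  (B != 0) || (C != 0) ->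
  cyc a b c d P = 0 -> cyc a b c d Q = 0 -> cyc a b c d S = 0 ->
  cyc 0 B C D P = 0 -> cyc 0 B C D Q = 0 -> cyc 0 B C D S = 0 -> a = 0.
Proof.
move=> /plane_neq PQ /plane_neq QS /plane_neq PS BC.
case: P Q S PQ QS PS => [x y] [x' y'] [x2 y2] /= PQ QS PS.
rewrite /cyc /= => f1 f2 f3 l1 l2 l3.
pose n := B ^+ 2 + C ^+ 2.
have n0 : n != 0.
  rewrite /n paddr_eq0 ?sqr_ge0// !sqrf_eq0 negb_and; exact: BC.
have lin X Y : 0 * (X ^+ 2 + Y ^+ 2) + B * X + C * Y + D = 0 ->
    exists s, X = x - s * C /\ Y = y + s * B.
  move=> l; exists ((B * (Y - y) - C * (X - x)) / n).
  have l' : B * (X - x) + C * (Y - y) = 0 by lra.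
  have eX : (X - x) * n = - C * (B * (Y - y) - C * (X - x)).
    transitivity (B * (B * (X - x) + C * (Y - y))
      - C * (B * (Y - y) - C * (X - x))); [rewrite /n; ring | by rewrite l'; ring].
  have eY : (Y - y) * n = B * (B * (Y - y) - C * (X - x)).
    transitivity (C * (B * (X - x) + C * (Y - y))
      + B * (B * (Y - y) - C * (X - x))); [rewrite /n; ring | by rewrite l'; ring].
  have {}eX : X - x = - C * (B * (Y - y) - C * (X - x)) / n.
    by rewrite -eX mulfK.
  have {}eY : Y - y = B * (B * (Y - y) - C * (X - x)) / n.
    by rewrite -eY mulfK.
  split.
    by rewrite -[LHS](subrK x) {1}eX; ring.
  by rewrite -[LHS](subrK y) {1}eY; ring.
have [s [ex' ey']] := lin _ _ l2; have [t [ex2 ey2]] := lin _ _ l3.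
subst x' y' x2 y2.
have s0 : s != 0.
  by apply: contraTneq PQ => ->; rewrite !mul0r !subr0 !addr0 !subrr eqxx.
have t0 : t != 0.
  by apply: contraTneq PS => ->; rewrite !mul0r !subr0 !addr0 !subrr eqxx.
have st : s - t != 0.
  rewrite subr_eq0; apply: contraTneq QS => ->.
  by rewrite !subrr eqxx.
pose L := a * 2 * (y * B - x * C) - b * C + c * B.
have e2 : s * (a * n * s + L) = 0.
  transitivity ((a * ((x - s * C) ^+ 2 + (y + s * B) ^+ 2) +
    b * (x - s * C) + c * (y + s * B) + d) -
    (a * (x ^+ 2 + y ^+ 2) + b * x + c * y + d)); first by rewrite /n /L; ring.
  by rewrite f1 f2 subrr.
have e3 : t * (a * n * t + L) = 0.
  transitivity ((a * ((x - t * C) ^+ 2 + (y + t * B) ^+ 2) +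
    b * (x - t * C) + c * (y + t * B) + d) -
    (a * (x ^+ 2 + y ^+ 2) + b * x + c * y + d)); first by rewrite /n /L; ring.
  by rewrite f1 f3 subrr.
move/eqP: e2; rewrite mulf_eq0 (negPf s0) /= => /eqP e2.
move/eqP: e3; rewrite mulf_eq0 (negPf t0) /= => /eqP e3.
have : a * n * (s - t) = 0 by lra.
by move/eqP; rewrite !mulf_eq0 (negPf n0) (negPf st) !orbF => /eqP.
Qed.

(* A combination cancelling the quadratic terms is affine; if it were not zero,
   the three points would be collinear and both cycles affine. *)
Lemma cycle_three_points f g P Q S : cycle f -> cycle g ->
  P <> Q -> Q <> S -> P <> S ->
  f P = 0 -> f Q = 0 -> f S = 0 -> g P = 0 -> g Q = 0 -> g S = 0 ->
  proportional f g.
Proof.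
move=> [a [b [c [d fE]]]] [a' [b' [c' [d' gE]]]] PQ QS PS.
rewrite !fE !gE => f1 f2 f3 g1 g2 g3 p q; rewrite !fE !gE {fE gE}.
set B := a' * b - a * b'; set C := a' * c - a * c'; set D := a' * d - a * d'.
have lE X : cyc 0 B C D X = a' * cyc a b c d X - a * cyc a' b' c' d' X.
  by rewrite /cyc /B /C /D; ring.
have l1 : cyc 0 B C D P = 0 by rewrite lE f1 g1; ring.
have l2 : cyc 0 B C D Q = 0 by rewrite lE f2 g2; ring.
have l3 : cyc 0 B C D S = 0 by rewrite lE f3 g3; ring.
have affine_case : a = 0 -> a' = 0 ->
    cyc a b c d p * cyc a' b' c' d' q = cyc a b c d q * cyc a' b' c' d' p.
  move=> a0 a'0; subst a a'; have /plane_neq nz := PQ.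
  have e : b * c' = b' * c.
    apply: (orthogonal_proportional nz).
      by move: f1 f2; rewrite /cyc; lra.
    by move: g1 g2; rewrite /cyc; lra.
  have fX X : cyc 0 b c d X = b * (X.1 - P.1) + c * (X.2 - P.2).
    by rewrite -[LHS](subrK (cyc 0 b c d P)) {2}f1 /cyc; ring.
  have gX X : cyc 0 b' c' d' X = b' * (X.1 - P.1) + c' * (X.2 - P.2).
    by rewrite -[LHS](subrK (cyc 0 b' c' d' P)) {2}g1 /cyc; ring.
  rewrite !fX !gX; apply/eqP; rewrite -subr_eq0; apply/eqP.
  transitivity ((b * c' - b' * c) * ((p.1 - P.1) * (q.2 - P.2)
    - (p.2 - P.2) * (q.1 - P.1))); first by ring.
  by rewrite e subrr mul0r.
have [BC|] := boolP ((B != 0) || (C != 0)).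
  apply: affine_case.
    exact: (cyc_collinear PQ QS PS BC f1 f2 f3 l1 l2 l3).
  exact: (cyc_collinear PQ QS PS BC g1 g2 g3 l1 l2 l3).
rewrite negb_or !negbK => /andP[/eqP B0 /eqP C0].
have D0 : D = 0 by move: l1; rewrite /cyc B0 C0; lra.
have h0 X : a' * cyc a b c d X = a * cyc a' b' c' d' X.
  by apply/eqP; rewrite -subr_eq0 -lE /cyc B0 C0 D0; apply/eqP; ring.
have [a0|a0] := eqVneq a 0.
  have [a'0|a'0] := eqVneq a' 0; first exact: affine_case.
  apply: (mulfI a'0).
  by rewrite mulrA (h0 p) [RHS]mulrA (h0 q); ring.
apply: (mulfI a0).
by rewrite mulrCA -(h0 q) [RHS]mulrCA -(h0 p); ring.
Qed.

(* [p] and [q] witness that [f] and [g] are not proportional; a combination of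
   [f] and [g] agreeing with [h] there must be [h]. *)
Lemma cycle_pencil f g h P Q : cycle f -> cycle g -> cycle h -> P <> Q ->
  ~ proportional f g -> f P = 0 -> f Q = 0 -> g P = 0 -> g Q = 0 ->
  h P = 0 -> h Q = 0 -> exists s t, forall p, h p = s * f p + t * g p.
Proof.
move=> cf cg ch PQ nfg fP fQ gP gQ hP hQ.
have [p [q pq]] : exists p q, f p * g q - f q * g p != 0.
  apply: contrapT => ex; apply: nfg => p q; apply/eqP; rewrite -subr_eq0.
  by apply/negPn/negP => ne; apply: ex; exists p, q.
set D := _ - _ in pq.
pose s := (h p * g q - h q * g p) / D; pose t := (f p * h q - f q * h p) / D.
exists s, t.
pose h' X := 1 * h X + (- 1) * (s * f X + t * g X).
pose k X := g p * f X + (- f p) * g X.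
have h'p : h' p = 0 by rewrite /h' /s /t; move: pq; rewrite /D => pq; field.
have h'q : h' q = 0 by rewrite /h' /s /t; move: pq; rewrite /D => pq; field.
have kp : k p = 0 by rewrite /k; ring.
have kq : k q != 0.
  by apply: contra_neq pq; rewrite /k /D => e; rewrite -[RHS]oppr0 -e; ring.
have ch' : cycle h' by apply: cycle_lin => //; apply: cycle_lin.
have ck : cycle k by apply: cycle_lin.
have pP : P <> p.
  by move=> e; move/eqP: pq; apply; rewrite /D -e fP gP; ring.
have pQ : Q <> p.
  by move=> e; move/eqP: pq; apply; rewrite /D -e fQ gQ; ring.
have prop : proportional h' k.
  apply: (cycle_three_points ch' ck PQ pQ pP) => //.
  - by rewrite /h' hP fP gP; ring.
  - by rewrite /h' hQ fQ gQ; ring.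
  - by rewrite /k fP gP; ring.
  - by rewrite /k fQ gQ; ring.
move=> X; have := prop X q; rewrite h'q mul0r => /eqP.
by rewrite mulf_eq0 (negPf kq) orbF /h' => /eqP e; lra.
Qed.

End Cycles.

Section PlanarPappus.
Variable R : realType.
Local Notation plane := (R * R)%type.
Implicit Types (f g h : plane -> R) (p q P Q S : plane).

Lemma proportional_sym f g : proportional f g -> proportional g f.
Proof. by move=> fg p q; rewrite mulrC -fg mulrC. Qed.

Lemma nonproportional_neq0 f g : ~ proportional f g -> exists p, f p != 0.
Proof.
move=> nfg; apply: contrapT => ex; apply: nfg => p q.
have f0 x : f x = 0.
  by apply/eqP/negPn/negP => ne; apply: ex; exists x.
by rewrite !f0 !mul0r.
Qed.

Lemma proportional_zero f g q :
  proportional f g -> (exists p, f p != 0) -> f q = 0 -> g q = 0.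
Proof.
move=> fg [p fp] fq; have /eqP := fg p q.
by rewrite fq mul0r mulf_eq0 (negPf fp) => /eqP.
Qed.

Lemma common_two f g P Q S : cycle f -> cycle g -> ~ proportional f g ->
  P <> Q -> f P = 0 -> f Q = 0 -> g P = 0 -> g Q = 0 ->
  f S = 0 -> g S = 0 -> S = P \/ S = Q.
Proof.
move=> cf cg nfg PQ fP fQ gP gQ fS gS.
have [|SP] := pselect (S = P); first by left.
have [|SQ] := pselect (S = Q); first by right.
case: nfg.
by apply: (@cycle_three_points R f g P Q S) => //; exact: not_eq_sym.
Qed.

Lemma pencil_step F (k : R) f g h P Q :
  cycle f -> cycle g -> cycle h -> P <> Q ->
  k != 0 -> (forall p, f p = k * F p) ->
  ~ proportional f h -> ~ proportional g h ->
  f P = 0 -> f Q = 0 -> g P = 0 -> g Q = 0 -> h P = 0 -> h Q = 0 ->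
  exists k' t, k' != 0 /\ forall p, g p = k' * (F p + t * h p).
Proof.
move=> cf cg ch PQ k0 fE nfh ngh fP fQ gP gQ hP hQ.
have [s [t gE]] := cycle_pencil cf ch cg PQ nfh fP fQ hP hQ gP gQ.
have s0 : s != 0.
  by apply/eqP => e; apply: ngh => p q; rewrite !gE e; ring.
exists (s * k), (t / (s * k)); split; first by rewrite mulf_neq0.
by move=> p; rewrite gE fE; field; rewrite k0 s0.
Qed.

Variables (A B f1 f2 f3 f4 f5 f6 : plane -> R).
Variables (A1 A2 A3 B1 B2 B3 A2' A3' B1' B2' B3' : plane).
Variables (P1 Q1 P2 Q2 P3 Q3 : plane).
Hypotheses (cA : cycle A) (cB : cycle B).
Hypotheses (c1 : cycle f1) (c2 : cycle f2) (c3 : cycle f3).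
Hypotheses (c4 : cycle f4) (c5 : cycle f5) (c6 : cycle f6).
Hypotheses (A12 : A1 <> A2) (A23 : A2 <> A3) (A13 : A1 <> A3).
Hypotheses (B12 : B1 <> B2) (B23 : B2 <> B3) (B13 : B1 <> B3).
Hypotheses (AA1 : A A1 = 0) (AA2 : A A2 = 0) (AA3 : A A3 = 0).
Hypotheses (BB1 : B B1 = 0) (BB2 : B B2 = 0) (BB3 : B B3 = 0).
Hypotheses (f1A1 : f1 A1 = 0) (f1B2 : f1 B2 = 0) (A1B2 : A1 <> B2).
Hypotheses (n1 : ~ proportional f1 B) (BB2' : B B2' = 0) (f1B2' : f1 B2' = 0).
Hypotheses (B2B2' : B2' <> B2).
Hypotheses (f2B2 : f2 B2 = 0) (f2A3 : f2 A3 = 0) (f2B2' : f2 B2' = 0).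
Hypotheses (B2A3 : B2 <> A3) (A3B2' : A3 <> B2').
Hypotheses (n2 : ~ proportional f2 A) (AA3' : A A3' = 0) (f2A3' : f2 A3' = 0).
Hypotheses (A3A3' : A3' <> A3).
Hypotheses (f3A3 : f3 A3 = 0) (f3B1 : f3 B1 = 0) (f3A3' : f3 A3' = 0).
Hypotheses (A3B1 : A3 <> B1) (B1A3' : B1 <> A3').
Hypotheses (n3 : ~ proportional f3 B) (BB1' : B B1' = 0) (f3B1' : f3 B1' = 0).
Hypotheses (B1B1' : B1' <> B1).
Hypotheses (f4B1 : f4 B1 = 0) (f4A2 : f4 A2 = 0) (f4B1' : f4 B1' = 0).
Hypotheses (B1A2 : B1 <> A2) (A2B1' : A2 <> B1').
Hypotheses (n4 : ~ proportional f4 A) (AA2' : A A2' = 0) (f4A2' : f4 A2' = 0).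
Hypotheses (A2A2' : A2' <> A2).
Hypotheses (f5A2 : f5 A2 = 0) (f5B3 : f5 B3 = 0) (f5A2' : f5 A2' = 0).
Hypotheses (A2B3 : A2 <> B3) (B3A2' : B3 <> A2').
Hypotheses (n5 : ~ proportional f5 B) (BB3' : B B3' = 0) (f5B3' : f5 B3' = 0).
Hypotheses (B3B3' : B3' <> B3).
Hypotheses (f6B3 : f6 B3 = 0) (f6A1 : f6 A1 = 0) (f6B3' : f6 B3' = 0).
Hypotheses (B3A1 : B3 <> A1) (A1B3' : A1 <> B3').
Hypotheses (n14 : ~ proportional f1 f4) (n63 : ~ proportional f6 f3).
Hypothesis (n25 : ~ proportional f2 f5).
Hypotheses (PQ1 : P1 <> Q1) (PQ2 : P2 <> Q2) (PQ3 : P3 <> Q3).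
Hypotheses (f1P : f1 P1 = 0) (f1Q : f1 Q1 = 0).
Hypotheses (f4P : f4 P1 = 0) (f4Q : f4 Q1 = 0).
Hypotheses (f6P : f6 P2 = 0) (f6Q : f6 Q2 = 0).
Hypotheses (f3P : f3 P2 = 0) (f3Q : f3 Q2 = 0).
Hypotheses (f2P : f2 P3 = 0) (f2Q : f2 Q3 = 0).
Hypotheses (f5P : f5 P3 = 0) (f5Q : f5 Q3 = 0).

(* Otherwise [B2'], [A3'], [B1'], [A2'], [B3'] would successively equal [A1]. *)
Let BA1 : B A1 <> 0.
Proof.
move=> BA1.
have two f : cycle f -> ~ proportional f B -> forall P Q, f P = 0 -> B P = 0 ->
    f Q = 0 -> B Q = 0 -> Q <> P -> f A1 = 0 -> A1 <> P -> A1 = Q.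
  move=> cf nf P Q fP BP fQ BQ QP fA AP.
  by have [|//] := common_two cf cB nf (not_eq_sym QP) fP fQ BP BQ fA BA1.
have e2 : A1 = B2' by apply: (two f1 c1 n1 B2).
have nsA f : cycle f -> ~ proportional f A -> forall P Q, f P = 0 -> A P = 0 ->
    f Q = 0 -> A Q = 0 -> Q <> P -> f A1 = 0 -> A1 <> P -> A1 = Q.
  move=> cf nf P Q fP AP fQ AQ QP fA nAP.
  by have [|//] := common_two cf cA nf (not_eq_sym QP) fP fQ AP AQ fA AA1.
have e3 : A1 = A3' by apply: (nsA f2 c2 n2 A3) => //; rewrite e2.
have e4 : A1 = B1'.
  apply: (two f3 c3 n3 B1) => //; first by rewrite e3.
  by rewrite e3; apply: not_eq_sym.
have e5 : A1 = A2' by apply: (nsA f4 c4 n4 A2) => //; rewrite e4.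
apply: A1B3'; apply: (two f5 c5 n5 B3) => //; first by rewrite e5.
exact: not_eq_sym.
Qed.

Let nA : exists p, A p != 0.
Proof. by apply: (@nonproportional_neq0 _ f2) => /proportional_sym. Qed.

Let nB : exists p, B p != 0.
Proof. by apply: (@nonproportional_neq0 _ f1) => /proportional_sym. Qed.

Let n1A : ~ proportional f1 A.
Proof.
move=> e; have z := proportional_zero e (nonproportional_neq0 n1).
apply: n2; apply: (@cycle_three_points R f2 A B2 A3 B2') => //; try exact: z.
exact: not_eq_sym.
Qed.

Let n2B : ~ proportional f2 B.
Proof.
move=> e; have z := proportional_zero e (nonproportional_neq0 n2).
apply: n3; apply: (@cycle_three_points R f3 B A3 B1 A3') => //; try exact: z.
exact: not_eq_sym.
Qed.

Let n3A : ~ proportional f3 A.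
Proof.
move=> e; have z := proportional_zero e (nonproportional_neq0 n3).
apply: n4; apply: (@cycle_three_points R f4 A B1 A2 B1') => //; try exact: z.
exact: not_eq_sym.
Qed.

Let n4B : ~ proportional f4 B.
Proof.
move=> e; have z := proportional_zero e (nonproportional_neq0 n4).
apply: n5; apply: (@cycle_three_points R f5 B A2 B3 A2') => //; try exact: z.
exact: not_eq_sym.
Qed.

Let n6B : ~ proportional f6 B.
Proof.
move=> e; have z := proportional_zero e (nonproportional_neq0 n63).
by apply: BA1; apply: z.
Qed.

Let independent (x y z : R) :
  (forall p, x * f1 p + y * A p + z * B p = 0) -> [/\ x = 0, y = 0 & z = 0].
Proof.
move=> e.
have y0 : y = 0.
  apply/eqP/negPn/negP => ny; apply: n2.
  have A0 p : f1 p = 0 -> B p = 0 -> A p = 0.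
    move=> f0 b0; have := e p; rewrite f0 b0 !mulr0 add0r addr0 => /eqP.
    by rewrite mulf_eq0 (negPf ny) => /eqP.
  apply: (@cycle_three_points R f2 A B2 A3 B2') => //; try exact: A0.
  exact: not_eq_sym.
have x0 : x = 0.
  apply/eqP/negPn/negP => nx; apply: n1 => p q.
  apply: (mulfI nx).
  have f1E r : x * f1 r = - (z * B r) by have := e r; rewrite y0; lra.
  by rewrite !mulrA !f1E; ring.
split=> //; have [p Bp] := nB; have /eqP := e p.
by rewrite x0 y0 !mul0r !add0r mulf_eq0 (negPf Bp) orbF => /eqP.
Qed.

Let all_through_two : A P1 = 0 -> A Q1 = 0 -> f2 P1 = 0 -> f2 Q1 = 0 -> False.
Proof.
move=> AP AQ f2P' f2Q'.
have h1 := common_two c1 cA n1A PQ1 f1P f1Q AP AQ f1A1 AA1.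
have h2 := common_two c4 cA n4 PQ1 f4P f4Q AP AQ f4A2 AA2.
have h3 := common_two c2 cA n2 PQ1 f2P' f2Q' AP AQ f2A3 AA3.
by case: h1 h2 h3 => [a|a] [b|b] [c|c]; move: A12 A23 A13; rewrite a b c.
Qed.

Let third_point :
  (f6 P1 = 0 -> f6 Q1 = 0 -> f3 P1 = 0 -> f3 Q1 = 0 -> f2 P1 = 0 ->
   f2 Q1 = 0 -> f5 P1 = 0 -> f5 Q1 = 0 -> A P1 = 0 /\ A Q1 = 0) ->
  exists2 S, [\/ S = P2, S = Q2, S = P3 | S = Q3] & S <> P1 /\ S <> Q1.
Proof.
move=> AP; apply: contrapT => ex.
have in2 S : [\/ S = P2, S = Q2, S = P3 | S = Q3] -> S = P1 \/ S = Q1.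
  move=> hS; have [|n] := pselect (S = P1); first by left.
  have [|n'] := pselect (S = Q1); first by right.
  by case: ex; exists S.
have same f P Q : P <> Q -> P = P1 \/ P = Q1 -> Q = P1 \/ Q = Q1 ->
    f P = 0 -> f Q = 0 -> f P1 = 0 /\ f Q1 = 0.
  by move=> PQ [e|e] [e'|e'] fP fQ; move: PQ fP fQ; rewrite e e'.
have P2in := in2 _ (Or41 _ _ _ (erefl P2)).
have Q2in := in2 _ (Or42 _ _ _ (erefl Q2)).
have P3in := in2 _ (Or43 _ _ _ (erefl P3)).
have Q3in := in2 _ (Or44 _ _ _ (erefl Q3)).
have [h6 h6'] := same f6 _ _ PQ2 P2in Q2in f6P f6Q.
have [h3 h3'] := same f3 _ _ PQ2 P2in Q2in f3P f3Q.
have [h2 h2'] := same f2 _ _ PQ3 P3in Q3in f2P f2Q.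
have [h5 h5'] := same f5 _ _ PQ3 P3in Q3in f5P f5Q.
by have [hP hQ] := AP h6 h6' h3 h3' h2 h2' h5 h5'; apply: all_through_two.
Qed.

Let chain : exists k2 k3 k4 b1 a1 b2, [/\ k2 != 0, k3 != 0 & k4 != 0] /\
  [/\ forall p, f2 p = k2 * (f1 p + b1 * B p),
      forall p, f3 p = k3 * (f1 p + b1 * B p + a1 * A p) &
      forall p, f4 p = k4 * (f1 p + b1 * B p + a1 * A p + b2 * B p)].
Proof.
have [|k2 [b1 [k20 e2]]] := @pencil_step f1 1 f1 f2 B B2 B2' c1 c2 cB
  (not_eq_sym B2B2') (oner_neq0 _) _ n1 n2B f1B2 f1B2' f2B2 f2B2' BB2 BB2'.
  by move=> p; rewrite mul1r.
have [k3 [a1 [k30 e3]]] := pencil_step c2 c3 cA (not_eq_sym A3A3') k20 e2 n2 n3A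
  f2A3 f2A3' f3A3 f3A3' AA3 AA3'.
have [k4 [b2 [k40 e4]]] := pencil_step c3 c4 cB (not_eq_sym B1B1') k30 e3 n3 n4B
  f3B1 f3B1' f4B1 f4B1' BB1 BB1'.
by exists k2, k3, k4, b1, a1, b2.
Qed.

Let not_12_and_34 : (forall p, f1 p = 0 -> f2 p = 0) ->
  (forall p, f2 p = 0 -> f1 p = 0) -> (forall p, f4 p = 0 -> f3 p = 0) -> False.
Proof.
move=> f12 f21 f43.
have [|e] := common_two c2 cA n2 (not_eq_sym A3A3') f2A3 f2A3' AA3 AA3'
  (f12 _ f1A1) AA1; first exact: A13.
have [|e'] := common_two c3 cA n3A (not_eq_sym A3A3') f3A3 f3A3' AA3 AA3'
  (f43 _ f4A2) AA2; first exact: A23.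
by apply: A12; rewrite e e'.
Qed.

Let not_16_and_23 : (forall p, f6 p = 0 -> f1 p = 0) ->
  (forall p, f3 p = 0 -> f2 p = 0) -> False.
Proof.
move=> f61 f32.
have [|e] := common_two c1 cB n1 (not_eq_sym B2B2') f1B2 f1B2' BB2 BB2'
  (f61 _ f6B3) BB3; first by apply: not_eq_sym.
have [|e'] := common_two c2 cB n2B (not_eq_sym B2B2') f2B2 f2B2' BB2 BB2'
  (f32 _ f3B1) BB1; first exact: B12.
by apply: B13; rewrite e e'.
Qed.

(* If [f5] is [A], then so is [f6]. *)
Let degenerate_cycle : proportional f5 A ->
  exists M, [/\ cycle M, exists p, M p != 0,
    M P1 = 0 /\ M Q1 = 0, M P2 = 0 /\ M Q2 = 0 & M P3 = 0 /\ M Q3 = 0].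
Proof.
move=> f5A; have z5 := proportional_zero f5A (nonproportional_neq0 n5).
have f6A : proportional f6 A.
  apply: (@cycle_three_points R f6 A B3 A1 B3') => //; try exact: z5.
  exact: not_eq_sym.
have z6 := proportional_zero f6A (nonproportional_neq0 n63).
have [k2 [k3 [k4 [b1 [a1 [b2 [[k20 k30 k40] [e2 e3 e4]]]]]]]] := chain.
have F2 p : f2 p = 0 -> f1 p + b1 * B p = 0.
  by rewrite e2 => /eqP; rewrite mulf_eq0 (negPf k20) => /eqP.
have F3 p : f3 p = 0 -> f1 p + b1 * B p + a1 * A p = 0.
  by rewrite e3 => /eqP; rewrite mulf_eq0 (negPf k30) => /eqP.
have F4 p : f4 p = 0 -> f1 p + b1 * B p + a1 * A p + b2 * B p = 0.
  by rewrite e4 => /eqP; rewrite mulf_eq0 (negPf k40) => /eqP.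
pose M p := (b1 + b2) * (1 * f1 p + b1 * B p) + (b1 * a1) * A p.
have M1 p : f1 p = 0 -> f4 p = 0 -> M p = 0.
  move=> h1 /F4 h4; transitivity (b2 * f1 p +
    b1 * (f1 p + b1 * B p + a1 * A p + b2 * B p)); first by rewrite /M; ring.
  by rewrite h4 h1; ring.
have M2 p : f6 p = 0 -> f3 p = 0 -> M p = 0.
  move=> /z6 h6 /F3 h3; transitivity ((b1 + b2) *
    (f1 p + b1 * B p + a1 * A p) - b2 * a1 * A p); first by rewrite /M; ring.
  by rewrite h3 h6; ring.
have M3 p : f2 p = 0 -> f5 p = 0 -> M p = 0.
  by move=> /F2 h2 /z5 h5; rewrite /M h5 mul1r h2; ring.
exists M; split; try by split; solve [by apply: M1 | by apply: M2 | by apply: M3].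
- by do 2 apply: cycle_lin => //.
apply: contrapT => M0.
have [|x0 y0 _] := @independent (b1 + b2) (b1 * a1) ((b1 + b2) * b1).
  move=> p; have -> : (b1 + b2) * f1 p + b1 * a1 * A p + (b1 + b2) * b1 * B p = M p.
    by rewrite /M; ring.
  by apply/eqP/negPn/negP => ne; apply: M0; exists p.
have b2E : b2 = - b1 by lra.
move/eqP: y0; rewrite mulf_eq0 => /orP[] /eqP e0.
  apply: not_12_and_34 => p.
  - by move=> h; rewrite e2 h e0; ring.
  - by move=> /F2; rewrite e0; lra.
  - by move=> /F4 h; rewrite e3; move: h; rewrite b2E e0 => h; apply/eqP;
      rewrite mulf_eq0 (negPf k30) /=; apply/eqP; lra.
apply: n14 => p q; rewrite !e4 b2E e0; ring.
Qed.

Let generic_cycle : ~ proportional f5 A ->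
  exists M, [/\ cycle M, exists p, M p != 0,
    M P1 = 0 /\ M Q1 = 0, M P2 = 0 /\ M Q2 = 0 & M P3 = 0 /\ M Q3 = 0] /\
   (f6 P1 = 0 -> f6 Q1 = 0 -> f3 P1 = 0 -> f3 Q1 = 0 -> f2 P1 = 0 ->
   f2 Q1 = 0 -> f5 P1 = 0 -> f5 Q1 = 0 -> A P1 = 0 /\ A Q1 = 0).
Proof.
move=> n5A.
have [k2 [k3 [k4 [b1 [a1 [b2 [[k20 k30 k40] [e2 e3 e4]]]]]]]] := chain.
have [k5 [a2 [k50 e5]]] := pencil_step c4 c5 cA (not_eq_sym A2A2') k40 e4 n4 n5A
  f4A2 f4A2' f5A2 f5A2' AA2 AA2'.
have [k6 [b3 [k60 e6]]] := pencil_step c5 c6 cB (not_eq_sym B3B3') k50 e5 n5 n6B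
  f5B3 f5B3' f6B3 f6B3' BB3 BB3'.
have b3E : b3 = - (b1 + b2).
  have /eqP := f6A1; rewrite e6 f1A1 AA1 mulf_eq0 (negPf k60) /= => /eqP e.
  have /eqP : (b1 + b2 + b3) * B A1 = 0 by rewrite -[RHS]e; ring.
  by rewrite mulf_eq0 => /orP[/eqP|/eqP //]; lra.
pose a3 := - (a1 + a2).
have F2 p : f2 p = 0 -> f1 p + b1 * B p = 0.
  by rewrite e2 => /eqP; rewrite mulf_eq0 (negPf k20) => /eqP.
have F3 p : f3 p = 0 -> f1 p + b1 * B p + a1 * A p = 0.
  by rewrite e3 => /eqP; rewrite mulf_eq0 (negPf k30) => /eqP.
have F4 p : f4 p = 0 -> f1 p - b3 * B p + a1 * A p = 0.
  rewrite e4 => /eqP; rewrite mulf_eq0 (negPf k40) /= => /eqP <-.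
  by rewrite b3E; ring.
have F5 p : f5 p = 0 -> f1 p - b3 * B p - a3 * A p = 0.
  rewrite e5 => /eqP; rewrite mulf_eq0 (negPf k50) /= => /eqP <-.
  by rewrite b3E /a3; ring.
have F6 p : f6 p = 0 -> f1 p - a3 * A p = 0.
  rewrite e6 => /eqP; rewrite mulf_eq0 (negPf k60) /= => /eqP <-.
  by rewrite b3E /a3; ring.
have e4' p : f4 p = k4 * (f1 p - b3 * B p + a1 * A p) by rewrite e4 b3E; ring.
have e5' p : f5 p = k5 * (f1 p - b3 * B p - a3 * A p).
  by rewrite e5 b3E /a3; ring.
have e6' p : f6 p = k6 * (f1 p - a3 * A p) by rewrite e6 b3E /a3; ring.
pose M p := - (a3 * b3 + a1 * b1 + a1 * b3) * f1 p
  + 1 * ((a1 * a3 * b1) * A p + (- a3 * b1 * b3) * B p).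
have M1 p : f1 p = 0 -> f4 p = 0 -> M p = 0.
  move=> h1 /F4 h4; transitivity (- (a3 * b3 + a1 * b1 + a1 * b3 + a3 * b1) *
    f1 p + a3 * b1 * (f1 p - b3 * B p + a1 * A p)); first by rewrite /M; ring.
  by rewrite h4 h1; ring.
have M2 p : f6 p = 0 -> f3 p = 0 -> M p = 0.
  move=> /F6 h6 /F3 h3; transitivity (- a3 * b3 *
    (f1 p + b1 * B p + a1 * A p) - a1 * (b1 + b3) * (f1 p - a3 * A p)).
    by rewrite /M; ring.
  by rewrite h3 h6; ring.
have M3 p : f2 p = 0 -> f5 p = 0 -> M p = 0.
  move=> /F2 h2 /F5 h5; transitivity (- (a1 + a3) * b3 * (f1 p + b1 * B p)
    - a1 * b1 * (f1 p - b3 * B p - a3 * A p)); first by rewrite /M; ring.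
  by rewrite h2 h5; ring.
have a13 : a1 = 0 -> a3 = 0 -> False.
  move=> a10 a30; apply: not_16_and_23 => p.
    by move=> /F6; rewrite a30; lra.
  by move=> /F3 h; rewrite e2 -[RHS](mulr0 k2) -[in RHS]h a10; ring.
exists M; split; last first.
  move=> h6 h6' h3 h3' h2 h2' _ _.
  have zA p : f1 p = 0 -> f2 p = 0 -> f3 p = 0 -> f6 p = 0 -> A p = 0.
    move=> g1 /F2 g2 /F3 g3 /F6 g6; apply/eqP/negPn/negP => Ap.
    apply: a13; apply: (mulIf Ap); lra.
  by split; apply: zA.
split; try by split; solve [by apply: M1 | by apply: M2 | by apply: M3].
- by do 2 apply: cycle_lin => //.
apply: contrapT => M0.
have [|x0 y0 z0] := @independent (- (a3 * b3 + a1 * b1 + a1 * b3))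
    (a1 * a3 * b1) (- a3 * b1 * b3).
  move=> p; transitivity (M p); first by rewrite /M; ring.
  by apply/eqP/negPn/negP => ne; apply: M0; exists p.
have [a30|a30] := eqVneq a3 0.
  have [a10|a10] := eqVneq a1 0; first exact: a13.
  have b13 : b1 + b3 = 0.
    by apply: (mulfI a10); rewrite mulr0; move: x0; rewrite a30; lra.
  apply: n25 => p q; rewrite !e2 !e5' a30 (_ : b3 = - b1); last by lra.
  by ring.
have [b10|b10] := eqVneq b1 0.
  have /eqP : b3 * (a3 + a1) = 0 by move: x0; rewrite b10; lra.
  rewrite mulf_eq0 => /orP[/eqP b30|/eqP a13E].
    apply: not_12_and_34 => p.
    - by move=> h; rewrite e2 h b10; ring.
    - by move=> /F2; rewrite b10; lra.
    - by move=> /F4 h; rewrite e3 -[RHS](mulr0 k3) -[in RHS]h b10 b30; ring.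
  apply: n63 => p q; rewrite !e6' !e3 b10 (_ : a1 = - a3); last by lra.
  by ring.
have a10 : a1 = 0.
  by move/eqP: y0; rewrite !mulf_eq0 (negPf a30) (negPf b10) !orbF => /eqP.
have b30 : b3 = 0.
  by move/eqP: z0; rewrite !mulf_eq0 oppr_eq0 (negPf a30) (negPf b10) => /eqP.
by apply: n14 => p q; rewrite !e4' a10 b30; ring.
Qed.

Theorem pappus_cycle : exists M S, [/\ cycle M, exists p, M p != 0,
    M P1 = 0 /\ M Q1 = 0, M P2 = 0 /\ M Q2 = 0 & M P3 = 0 /\ M Q3 = 0] /\
  [/\ [\/ S = P2, S = Q2, S = P3 | S = Q3], S <> P1 & S <> Q1].
Proof.
have [f5A|n5A] := pselect (proportional f5 A).
  have [M hM] := degenerate_cycle f5A.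
  have [|S hS [SP SQ]] := third_point; last by exists M, S.
  have z5 := proportional_zero f5A (nonproportional_neq0 n5).
  by move=> _ _ _ _ _ _ h5 h5'; split; apply: z5.
have [M [hM /third_point[S hS [SP SQ]]]] := generic_cycle n5A.
by exists M, S.
Qed.

End PlanarPappus.

Section Cylinders.
Variable R : realType.
Local Notation space := 'rV[R]_3.
Local Notation plane := (R * R)%type.

Definition pr (p : space) : plane := (xc p, yc p).

Definition lift_pt (p : plane) : space :=
  \row_(i < 3) (if i == 0 then p.1 else if i == 1 then p.2 else 0).

Lemma lift_ptK p : pr (lift_pt p) = p.
Proof. by case: p => x y; rewrite /pr /xc /yc !mxE. Qed.

Lemma base_lift_pt p : base_plane (lift_pt p).
Proof. by rewrite /base_plane /= /zc mxE. Qed.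

Lemma space_ext (p q : space) : xc p = xc q -> yc p = yc q -> zc p = zc q ->
  p = q.
Proof.
rewrite /xc /yc /zc => h0 h1 h2; apply/rowP => i.
case: i => -[|[|[|//]]] h; [move: h0 | move: h1 | move: h2];
  by congr (_ = _); congr (_ _ _); apply/val_inj.
Qed.

Lemma pr_inj_base (p q : space) : base_plane p -> base_plane q -> p <> q ->
  pr p <> pr q.
Proof.
rewrite /base_plane /= => p0 q0 pq [ex ey]; apply: pq.
by apply: space_ext => //; rewrite p0 q0.
Qed.

Lemma fibreE (p q : space) : fibre p q <-> pr q = pr p.
Proof. by split=> [[ex ey]|[ex ey]]; [congr pair|split]. Qed.

Lemma fibre_refl (p : space) : fibre p p.
Proof. exact/fibreE. Qed.

Lemma sum_sqr_gt0 (u v : R) : (u != 0) || (v != 0) -> 0 < u ^+ 2 + v ^+ 2.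
Proof.
move=> nz; rewrite lt_neqAle addr_ge0 ?sqr_ge0// andbT eq_sym paddr_eq0 ?sqr_ge0//.
by rewrite !sqrf_eq0 negb_and.
Qed.

Lemma cycle_through (P Q S : plane) : P <> Q ->
  exists f, [/\ cycle f, exists p, f p != 0, f P = 0, f Q = 0 & f S = 0].
Proof.
move=> /plane_neq; case: P Q S => [x y] [x' y'] [x2 y2] /= /sum_sqr_gt0 nz.
pose l (p : plane) := (p.1 - x) * (y' - y) - (p.2 - y) * (x' - x).
pose k (p : plane) := (p.1 - x) * (p.1 - x') + (p.2 - y) * (p.2 - y').
have cl : cycle l.
  exists 0, (y' - y), (- (x' - x)), (- x * (y' - y) + y * (x' - x)) => p.
  by rewrite /l /cyc; ring.
have ck : cycle k.
  exists 1, (- (x + x')), (- (y + y')), (x * x' + y * y') => p.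
  by rewrite /k /cyc; ring.
have [l0|l0] := eqVneq (l (x2, y2)) 0.
  exists l; split => //; [|rewrite /l /=; ring|rewrite /l /=; ring].
  exists (x + (y' - y), y - (x' - x)).
  rewrite (_ : l _ = (x - x') ^+ 2 + (y - y') ^+ 2) ?gt_eqF//.
  by rewrite /l /=; ring.
exists (fun p => l (x2, y2) * k p + (- k (x2, y2)) * l p); split.
- exact: cycle_lin.
- exists ((x + x') / 2, (y + y') / 2).
  rewrite (_ : _ + _ = l (x2, y2) * (- ((x - x') ^+ 2 + (y - y') ^+ 2) / 4)).
    by rewrite mulf_neq0// mulf_neq0 ?invr_neq0 ?pnatr_eq0// oppr_eq0 gt_eqF.
  by rewrite /l /k /=; field.
- by rewrite /l /k /=; ring.
- by rewrite /l /k /=; ring.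
- by ring.
Qed.

Lemma cycle_zero_set (f : plane -> R) P Q : cycle f -> (exists p, f p != 0) ->
  P <> Q -> f P = 0 -> f Q = 0 ->
  (exists a b r, 0 < r /\
     forall p, f p = 0 <-> (p.1 - a) ^+ 2 + (p.2 - b) ^+ 2 = r ^+ 2) \/
  (exists a b d, (a != 0 \/ b != 0) /\
     forall p, f p = 0 <-> a * p.1 + b * p.2 = d).
Proof.
move=> [a [b [c [d fE]]]] [p0 fp0] /plane_neq/sum_sqr_gt0 PQ fP fQ.
have [a0|a0] := eqVneq a 0.
  right; exists b, c, (- d); split; last first.
    by move=> p; rewrite fE /cyc a0; split=> h; lra.
  have [b0|] := eqVneq b 0; [right|by left].
  apply: contra_neq fp0 => c0; rewrite -fP !fE /cyc a0 b0 c0; ring.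
left; pose x := - b / (2 * a); pose y := - c / (2 * a).
pose rho := x ^+ 2 + y ^+ 2 - d / a.
have fE' p : f p = a * ((p.1 - x) ^+ 2 + (p.2 - y) ^+ 2 - rho).
  by rewrite fE /cyc /rho /x /y; field.
have fE0 p : f p = 0 <-> (p.1 - x) ^+ 2 + (p.2 - y) ^+ 2 = rho.
  rewrite fE'; split=> [/eqP|->]; last by rewrite subrr mulr0.
  by rewrite mulf_eq0 (negPf a0) subr_eq0 => /eqP.
move/fE0 : fP => fP; move/fE0 : fQ => fQ.
have rho0 : 0 < rho.
  have := sqr_ge0 (P.1 + Q.1 - 2 * x); have := sqr_ge0 (P.2 + Q.2 - 2 * y).
  lra.
exists x, y, (Num.sqrt rho); split; first by rewrite sqrtr_gt0.
by move=> p; rewrite sqr_sqrtr ?ltW.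
Qed.

Lemma circle_or_line_cycle (S : set space) : circle_or_line S ->
  exists f : plane -> R, [/\ cycle f, exists p, f p != 0 &
    forall p, S p <-> base_plane p /\ f (pr p) = 0].
Proof.
case=> [[c [r [r0 ->]]]|[a [b [d [ab ->]]]]].
  exists (fun p => (p.1 - xc c) ^+ 2 + (p.2 - yc c) ^+ 2 - r ^+ 2); split.
  - exists 1, (- 2 * xc c), (- 2 * yc c), (xc c ^+ 2 + yc c ^+ 2 - r ^+ 2) => p.
    by rewrite /cyc; ring.
  - exists (xc c, yc c) => /=.
    by rewrite !subrr expr0n /= !add0r oppr_eq0 sqrf_eq0 gt_eqF.
  - move=> p; rewrite /circle /=; split=> -[pb e]; split => //.
      by rewrite e subrr.
    by apply/eqP; rewrite -subr_eq0; apply/eqP.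
exists (fun p => a * p.1 + b * p.2 - d); split.
- by exists 0, a, b, (- d) => p; rewrite /cyc; ring.
- apply: contrapT => ex.
  have z p : a * p.1 + b * p.2 - d = 0.
    by apply/eqP/negPn/negP => ne; apply: ex; exists p.
  have := z (0, 0); have := z (a, b) => /= e e'.
  by have := sum_sqr_gt0 (introT orP ab); lra.
- move=> p; rewrite /line /=; split=> -[pb e]; split => //.
    by rewrite e subrr.
  by apply/eqP; rewrite -subr_eq0; apply/eqP.
Qed.

Lemma cylinderE (X Y Z : space) (f : plane -> R) :
  base_plane X -> base_plane Y -> base_plane Z -> distinct3 X Y Z ->
  cycle f -> (exists p, f p != 0) ->
  f (pr X) = 0 -> f (pr Y) = 0 -> f (pr Z) = 0 ->
  cylinder X Y Z = [set p | f (pr p) = 0].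
Proof.
move=> X0 Y0 Z0 [XY YZ XZ] cf nf fX fY fZ.
have pXY := pr_inj_base X0 Y0 XY.
have pYZ := pr_inj_base Y0 Z0 YZ.
have pXZ := pr_inj_base X0 Z0 XZ.
apply/seteqP; split=> p /=.
  move=> [S [/circle_or_line_cycle[g [cg ng gE]] [SX SY SZ]] [q Sq /fibreE ->]].
  have [[_ gX] [_ gY] [_ gZ] [_ gq]] :=
    And4 (proj1 (gE _) SX) (proj1 (gE _) SY) (proj1 (gE _) SZ) (proj1 (gE _) Sq).
  by apply: (proportional_zero _ ng gq); apply: (cycle_three_points cg cf pXY pYZ pXZ).
move=> fp.
have [[a [b [r [r0 fE]]]]|[a [b [d [ab fE]]]]] := cycle_zero_set cf nf pXY fX fY.
  exists (circle (lift_pt (a, b)) r) => /=; last first.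
    exists (lift_pt (pr p)); last by apply/fibreE; rewrite lift_ptK.
    split; first exact: base_lift_pt.
    move/fE : fp => /= <-; rewrite /= /xc /yc !mxE //=.
  split; first by left; exists (lift_pt (a, b)), r.
  have aE : (xc (lift_pt (a, b)) = a) * (yc (lift_pt (a, b)) = b).
    by rewrite /xc /yc !mxE.
  by split; split => //=; rewrite !aE; apply/(fE (_, _)).
exists (line a b d) => /=; last first.
  exists (lift_pt (pr p)); last by apply/fibreE; rewrite lift_ptK.
  split; first exact: base_lift_pt.
  by move/fE : fp => /= <-; rewrite /= /xc /yc !mxE.
split; first by right; exists a, b, d.
by split; split => //=; apply/(fE (_, _)).
Qed.

Lemma cylinder_cycle (X Y Z : space) :
  base_plane X -> base_plane Y -> base_plane Z -> distinct3 X Y Z ->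
  exists f : plane -> R, [/\ cycle f, exists p, f p != 0,
    f (pr X) = 0 /\ f (pr Y) = 0, f (pr Z) = 0 &
    cylinder X Y Z = [set p | f (pr p) = 0]].
Proof.
move=> X0 Y0 Z0 D; have [XY _ _] := D.
have [f [cf nf fX fY fZ]] := cycle_through (pr Z) (pr_inj_base X0 Y0 XY).
by exists f; split => //; apply: cylinderE.
Qed.

Lemma zero_set_neq (f g : plane -> R) (K K' : set space) :
  (exists p, f p != 0) -> (exists p, g p != 0) ->
  K = [set p | f (pr p) = 0] -> K' = [set p | g (pr p) = 0] ->
  K <> K' -> ~ proportional f g.
Proof.
move=> nf ng -> -> ne fg; apply: ne; apply/seteqP; split=> p /=.
  exact: proportional_zero.
by apply: proportional_zero => //; apply: proportional_sym.
Qed.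

Lemma meet_in_two_fibres_zeros (f g : plane -> R) (K K' m m' : set space) :
  (exists p, f p != 0) -> (exists p, g p != 0) ->
  K = [set p | f (pr p) = 0] -> K' = [set p | g (pr p) = 0] ->
  meet_in_two_fibres K K' m m' ->
  ~ proportional f g /\ exists P Q : plane,
    [/\ P <> Q, m = [set p | pr p = P], m' = [set p | pr p = Q],
        f P = 0 /\ f Q = 0 & g P = 0 /\ g Q = 0].
Proof.
move=> nf ng KE K'E [KK' [p mE] [q m'E] mm' mm]; split.
  exact: (zero_set_neq nf ng KE K'E).
have fibE x : fibre x = [set y | pr y = pr x].
  by apply/seteqP; split=> y /fibreE.
have [Kp K'p] : (K `&` K') p by rewrite mm mE; left; apply: fibre_refl.
have [Kq K'q] : (K `&` K') q by rewrite mm m'E; right; apply: fibre_refl.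
exists (pr p), (pr q); rewrite -!fibE.
move: Kp K'p Kq K'q; rewrite KE K'E /= => Kp K'p Kq K'q.
split=> //; first by move=> e; apply: mm'; rewrite mE m'E !fibE e.
Qed.

Lemma other_common_fibre_zeros (f g : plane -> R) (K K' : set space) (X Y : space) :
  (exists p, f p != 0) -> (exists p, g p != 0) ->
  K = [set p | f (pr p) = 0] -> K' = [set p | g (pr p) = 0] ->
  base_plane X -> other_common_fibre K K' X Y ->
  [/\ ~ proportional f g, g (pr Y) = 0, f (pr Y) = 0 & pr Y <> pr X].
Proof.
move=> nf ng KE K'E X0 [KK' Y0 YX sub].
have [KY K'Y] := sub _ (fibre_refl Y).
split; first exact: (zero_set_neq nf ng KE K'E).
- by move: K'Y; rewrite K'E.
- by move: KY; rewrite KE.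
- exact: pr_inj_base.
Qed.

Theorem pappus_fibres (A1 A2 A3 B1 B2 B3 A1' A2' A3' B1' B2' B3' : space)
    (m1 m2 m3 m1' m2' m3' : set space) :
  pappus_configuration A1 A2 A3 B1 B2 B3 A1' A2' A3' B1' B2' B3'
    m1 m2 m3 m1' m2' m3' ->
  exists (M : plane -> R) (P1 Q1 P2 Q2 P3 Q3 S : plane),
    [/\ m1 = [set p | pr p = P1] /\ m1' = [set p | pr p = Q1],
        m2 = [set p | pr p = P2] /\ m2' = [set p | pr p = Q2],
        m3 = [set p | pr p = P3] /\ m3' = [set p | pr p = Q3],
        [/\ cycle M, exists p, M p != 0,
          M P1 = 0 /\ M Q1 = 0, M P2 = 0 /\ M Q2 = 0 & M P3 = 0 /\ M Q3 = 0] &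
        [/\ P1 <> Q1, [\/ S = P2, S = Q2, S = P3 | S = Q3], S <> P1 & S <> Q1]].
Proof.
move=> [[A10 A20 A30] [B10 B20 B30] dA dB A1'0 A1'A dK1 hB2' dK2 hA3' dK3 hB1'
  dK4 hA2' dK5 hB3' dK6 hm1 hm2 hm3].
have [[_ B2'0 _ _] [_ A3'0 _ _]] := (hB2', hA3').
have [[_ B1'0 _ _] [_ A2'0 _ _]] := (hB1', hA2').
have [_ B3'0 _ _] := hB3'.
have [A [cA nA [AA1 AA2] AA3 AE]] := cylinder_cycle A10 A20 A30 dA.
have [B [cB nB [BB1 BB2] BB3 BE]] := cylinder_cycle B10 B20 B30 dB.
have [f1 [c1 n1 [f1a f1b] f1c f1E]] := cylinder_cycle A10 B20 A1'0 dK1.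
have [f2 [c2 n2 [f2a f2b] f2c f2E]] := cylinder_cycle B20 A30 B2'0 dK2.
have [f3 [c3 n3 [f3a f3b] f3c f3E]] := cylinder_cycle A30 B10 A3'0 dK3.
have [f4 [c4 n4 [f4a f4b] f4c f4E]] := cylinder_cycle B10 A20 B1'0 dK4.
have [f5 [c5 n5 [f5a f5b] f5c f5E]] := cylinder_cycle A20 B30 A2'0 dK5.
have [f6 [c6 n6 [f6a f6b] f6c f6E]] := cylinder_cycle B30 A10 B3'0 dK6.
have [p1 BB2' f1B2' B2B2'] := other_common_fibre_zeros n1 nB f1E BE B20 hB2'.
have [p2 AA3' f2A3' A3A3'] := other_common_fibre_zeros n2 nA f2E AE A30 hA3'.
have [p3 BB1' f3B1' B1B1'] := other_common_fibre_zeros n3 nB f3E BE B10 hB1'.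
have [p4 AA2' f4A2' A2A2'] := other_common_fibre_zeros n4 nA f4E AE A20 hA2'.
have [p5 BB3' f5B3' B3B3'] := other_common_fibre_zeros n5 nB f5E BE B30 hB3'.
have [n14 [P1 [Q1 [PQ1 m1E m1'E [f1P f1Q] [f4P f4Q]]]]] :=
  meet_in_two_fibres_zeros n1 n4 f1E f4E hm1.
have [n63 [P2 [Q2 [PQ2 m2E m2'E [f6P f6Q] [f3P f3Q]]]]] :=
  meet_in_two_fibres_zeros n6 n3 f6E f3E hm2.
have [n25 [P3 [Q3 [PQ3 m3E m3'E [f2P f2Q] [f5P f5Q]]]]] :=
  meet_in_two_fibres_zeros n2 n5 f2E f5E hm3.
case: dA dB dK1 dK2 dK3 dK4 dK5 dK6 => [A12 A23 A13] [B12 B23 B13].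
move=> [K11 K12 K13] [K21 K22 K23] [K31 K32 K33] [K41 K42 K43] [K51 K52 K53]
  [K61 K62 K63].
have [] := @pappus_cycle R A B f1 f2 f3 f4 f5 f6 (pr A1) (pr A2) (pr A3) (pr B1)
  (pr B2) (pr B3) (pr A2') (pr A3') (pr B1') (pr B2') (pr B3') P1 Q1 P2 Q2 P3 Q3;
  try by [|apply: pr_inj_base].
move=> M [S [hM [hS SP SQ]]].
by exists M, P1, Q1, P2, Q2, P3, Q3, S.
Qed.

End Cylinders.

Section SmoothMaps.
Variable R : realType.
Local Notation space := 'rV[R]_3.
Implicit Types (f g : space -> R) (phi psi : space -> space).

Lemma CkSW (W : normedModType R) n (f : space -> W) : Ck n.+1 f -> Ck n f.
Proof.
elim: n f => [|n IH] f [df pf]; first by move=> p; apply: differentiable_continuous.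
by split=> // i; apply/IH/pf.
Qed.

Lemma partialD f g i p : differentiable f p -> differentiable g p ->
  partial i (fun q => f q + g q) p = partial i f p + partial i g p.
Proof. by move=> df dg; apply: deriveD; apply: diff_derivable. Qed.

Lemma partialM f g i p : differentiable f p -> differentiable g p ->
  partial i (fun q => f q * g q) p = f p * partial i g p + g p * partial i f p.
Proof. by move=> df dg; apply: deriveM; apply: diff_derivable. Qed.

Lemma Ck_cst n (c : R) : Ck n (fun _ : space => c).
Proof.
elim: n c => [|n IH] c /=; first by move=> p; apply: cst_continuous.
split=> [p|i]; first exact: differentiable_cst.
rewrite (_ : partial i _ = fun _ => 0) //.
by apply/funext => p; apply: derive_cst.
Qed.

Lemma Ck_add n f g : Ck n f -> Ck n g -> Ck n (fun p => f p + g p).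
Proof.
elim: n f g => [|n IH] f g; first by move=> cf cg p; exact: (cvgD (cf p) (cg p)).
move=> [df pf] [dg pg]; split=> [p|i]; first exact: differentiableD.
rewrite (_ : partial i _ = fun p => partial i f p + partial i g p).
  exact: IH (pf i) (pg i).
by apply/funext => p; apply: partialD.
Qed.

Lemma Ck_mul n f g : Ck n f -> Ck n g -> Ck n (fun p => f p * g p).
Proof.
elim: n f g => [|n IH] f g; first by move=> cf cg p; exact: (cvgM (cf p) (cg p)).
move=> Cf Cg; have [df pf] := Cf; have [dg pg] := Cg.
split=> [p|i]; first exact: differentiableM.
rewrite (_ : partial i _ = fun p => f p * partial i g p + g p * partial i f p).
  apply: Ck_add.
    exact: IH (CkSW Cf) (pg i).
  exact: IH (CkSW Cg) (pf i).
by apply/funext => p; apply: partialM.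
Qed.

Lemma Ck_sum n m (F : 'I_m -> space -> R) : (forall k, Ck n (F k)) ->
  Ck n (fun p => \sum_(k < m) F k p).
Proof.
elim: m F => [|m IH] F CF.
  rewrite (_ : (fun p => _) = fun _ => 0); first exact: Ck_cst.
  by apply/funext => p; rewrite big_ord0.
rewrite (_ : (fun p => _) = fun p => \sum_(k < m) F (widen_ord (leqnSn m) k) p
  + F ord_max p); first by apply: Ck_add => //; apply: IH.
by apply/funext => p; rewrite big_ord_recr.
Qed.

Lemma differentiable_coordf phi p k : differentiable phi p ->
  differentiable (fun q => phi q 0 k : R) p.
Proof.
by move=> d; apply: (@differentiable_comp _ _ _ _ phi (fun M : space => M 0 k : R)) => //;
  apply: differentiable_coord.
Qed.

Lemma rowE (v : space) : v = \sum_(k < 3) v 0 k *: basis_vec R k.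
Proof. exact: row_sum_delta. Qed.

Lemma differentiable_rowP phi p :
  (forall k, differentiable (fun q => phi q 0 k : R) p) -> differentiable phi p.
Proof.
move=> d; rewrite (_ : phi = fun q => \sum_(k < 3) phi q 0 k *: basis_vec R k); last first.
  by apply/funext => q; apply: rowE.
rewrite (_ : (fun q => _) = \sum_(k < 3) (fun q => phi q 0 k *: basis_vec R k)); last first.
  by apply/funext => q; rewrite fct_sumE.
apply: differentiable_sum => k; exact: (@differentiableZl _ _ _ (fun q => phi q 0 k)).
Qed.

Lemma partial_coord phi p i k : differentiable phi p ->
  partial i phi p 0 k = partial i (fun q => phi q 0 k : R) p.
Proof.
move=> d; rewrite /partial derive_mx ?mxE//; exact: diff_derivable.
Qed.

Lemma smooth_coord phi k : smooth phi -> smooth (fun q => phi q 0 k : R).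
Proof.
move=> sphi n; move: (sphi n.+1) => {sphi}.
elim: n phi => [|n IH] phi.
  by move=> [d _] p; apply: differentiable_continuous; apply: differentiable_coordf.
move=> [d pd]; split=> [p|i]; first exact: differentiable_coordf.
rewrite (_ : partial i _ = fun q => partial i phi q 0 k); first exact: IH _ (pd i).
by apply/funext => q; rewrite partial_coord.
Qed.

Lemma smooth_partial (W : normedModType R) i (f : space -> W) :
  smooth f -> smooth (partial i f).
Proof. by move=> sf n; exact: (sf n.+1).2. Qed.

Lemma smooth_differentiable (W : normedModType R) (f : space -> W) p :
  smooth f -> differentiable f p.
Proof. by move=> sf; have [d _] := sf 1%N. Qed.

Lemma smooth_row phi : (forall k, smooth (fun q => phi q 0 k : R)) -> smooth phi.
Proof.
move=> s n; elim: n phi s => [|n IH] phi s.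
  move=> p; apply: differentiable_continuous; apply: differentiable_rowP => k.
  exact: smooth_differentiable.
have d p : differentiable phi p.
  by apply: differentiable_rowP => k; apply: smooth_differentiable.
split=> // i; apply: IH => k.
rewrite (_ : (fun q => _) = partial i (fun q => phi q 0 k : R)).
  exact: smooth_partial.
by apply/funext => q; apply: partial_coord.
Qed.

Lemma partial_comp f phi i p : differentiable phi p -> differentiable f (phi p) ->
  partial i (fun q => f (phi q)) p =
  \sum_(k < 3) partial k f (phi p) * partial i (fun q => phi q 0 k : R) p.
Proof.
move=> dphi df; rewrite /partial.
rewrite [LHS]deriveE; last exact: differentiable_comp.
rewrite (diff_comp dphi df) /= -(deriveE (basis_vec R i) dphi).
rewrite [X in 'd f _ X]rowE linear_sum; apply: eq_bigr => k _.
rewrite linearZ /= -(deriveE _ df) [LHS]mulrC; congr (_ * _).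
exact: partial_coord.
Qed.

Lemma Ck_comp n f phi : smooth phi -> Ck n f -> Ck n (fun p => f (phi p)).
Proof.
move=> sphi; elim: n f => [|n IH] f.
  by move=> cf p; apply: continuous_comp; [exact: (sphi 0%N) | exact: cf].
move=> [df pf]; split=> [p|i].
  by apply: differentiable_comp => //; apply: smooth_differentiable.
rewrite (_ : partial i _ = fun p =>
  \sum_(k < 3) partial k f (phi p) * partial i (fun q => phi q 0 k : R) p).
  apply: Ck_sum => k; apply: Ck_mul; first exact: IH _ (pf k).
  by apply: smooth_partial; apply: smooth_coord.
by apply/funext => p; apply: partial_comp => //; apply: smooth_differentiable.
Qed.

Lemma smooth_comp phi psi : smooth phi -> smooth psi ->
  smooth (fun p => phi (psi p)).
Proof.
move=> sphi spsi; apply: smooth_row => k n.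
by apply: (@Ck_comp n (fun q => phi q 0 k)) => //; apply: smooth_coord.
Qed.

Lemma differentiable_idspace (p : space) : differentiable (@id space) p.
Proof. exact: ex_diff. Qed.

Lemma diff_idspace (p w : space) : 'd (@id space) p w = w.
Proof. by rewrite diff_val. Qed.

Lemma diff_comp_smooth phi psi p w : smooth phi -> smooth psi ->
  'd (fun q => phi (psi q)) p w = 'd phi (psi p) ('d psi p w).
Proof.
move=> sphi spsi.
have e := diff_comp (smooth_differentiable p spsi) (smooth_differentiable (psi p) sphi).
change ('d (phi \o psi) p w = ('d phi (psi p) \o 'd psi p) w).
by rewrite -e.
Qed.

Lemma smooth_translation (v : space) : smooth (fun p : space => p + v).
Proof.
have d p : differentiable (fun p : space => p + v) p.
  by apply: differentiableD; [exact: differentiable_idspace | exact: differentiable_cst].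
apply: smooth_row => k [|n].
  by move=> p; apply: differentiable_continuous; apply: differentiable_coordf.
split=> [p|i]; first exact: differentiable_coordf.
rewrite (_ : partial i _ = fun _ => basis_vec R i 0 k); first exact: Ck_cst.
apply/funext => p; rewrite -partial_coord // /partial.
have -> : (fun p : space => p + v) = id + cst v by [].
rewrite deriveD; [|exact: derivable_id|exact: derivable_cst].
by rewrite derive_id derive_cst addr0.
Qed.

End SmoothMaps.

Section Isometries.
Variable R : realType.
Local Notation space := 'rV[R]_3.
Variable g : metric R.
Implicit Types (phi psi : space -> space) (G : set space).

Lemma isometry_id : Defs.isometry g id.
Proof.
have sid : smooth (@id space).
  rewrite (_ : id = fun p : space => p + 0); first exact: smooth_translation.
  by apply/funext => p; rewrite addr0.
split; [exact: sid|by exists id|].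
by move=> p u v; rewrite !diff_idspace.
Qed.

Lemma isometry_comp phi psi : Defs.isometry g phi -> Defs.isometry g psi ->
  Defs.isometry g (fun p => phi (psi p)).
Proof.
move=> [s1 [i1 [si1 k1 k1']] m1] [s2 [i2 [si2 k2 k2']] m2]; split.
- exact: smooth_comp.
- exists (fun p => i2 (i1 p)); split; first exact: smooth_comp.
    by move=> p; rewrite k1 k2.
  by move=> p; rewrite k2' k1'.
- move=> p u v; have e w := diff_comp_smooth p w s1 s2.
  exact: eq_trans (congr2 (g _) (e u) (e v)) (eq_trans (m1 _ _ _) (m2 _ _ _)).
Qed.

Lemma isometry_inv phi psi : Defs.isometry g phi -> smooth psi -> cancel phi psi ->
  cancel psi phi -> Defs.isometry g psi.
Proof.
move=> [s _ m] spsi k k'; split; [exact: spsi|by exists phi|].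
move=> p u v.
have dK w : 'd phi (psi p) ('d psi p w) = w.
  have e := diff_comp_smooth p w s spsi.
  have idE : (fun q => phi (psi q)) = id by apply/funext => q; rewrite k'.
  exact: eq_trans (esym e) (eq_trans (congr1 (fun F : space -> space => 'd F p w) idE)
    (diff_idspace p w)).
have e := m (psi p) ('d psi p u) ('d psi p v).
have e' := congr2 (g (phi (psi p))) (dK u) (dK v).
exact: eq_trans (esym e) (eq_trans e' (congr1 (fun q => g q u v) (k' p))).
Qed.

Lemma equivalent_refl G : equivalent g G G.
Proof. by exists id; [exact: isometry_id | rewrite image_id]. Qed.

Lemma equivalent_sym G G' : equivalent g G G' -> equivalent g G' G.
Proof.
move=> [phi iphi <-]; have [_ [psi [spsi k k']] _] := iphi.
exists psi; first exact: isometry_inv iphi spsi k k'.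
by rewrite image_comp (_ : psi \o phi = id) ?image_id//; apply/funext.
Qed.

Lemma equivalent_trans G1 G2 G3 :
  equivalent g G1 G2 -> equivalent g G2 G3 -> equivalent g G1 G3.
Proof.
move=> [phi iphi <-] [psi ipsi <-].
exists (fun p => psi (phi p)); first exact: isometry_comp.
by rewrite image_comp.
Qed.

Lemma geodesic_class_eq (C : set (set space)) G G' : geodesic_class g C ->
  C G -> equivalent g G' G -> C = [set H | geodesic g H /\ equivalent g G' H].
Proof.
move=> [G0 gG0 ->] [gG eG] eG'; apply/seteqP; split=> H [gH eH]; split => //.
  apply: (equivalent_trans eG'); apply: equivalent_trans eH.
  exact: equivalent_sym.
apply: (equivalent_trans eG); apply: equivalent_trans eH.
exact: equivalent_sym.
Qed.

End Isometries.

Section VerticalTranslations.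
Variable R : realType.
Local Notation space := 'rV[R]_3.

Definition vertical (c : R) (p : space) : space := p + c *: basis_vec R 2.

Lemma verticalE c p : [/\ xc (vertical c p) = xc p, yc (vertical c p) = yc p &
  zc (vertical c p) = zc p + c].
Proof. by rewrite /vertical /xc /yc /zc !mxE /= !mulr0 !addr0 mulr1. Qed.

Lemma vertical_isometry c : Defs.isometry (@nil_metric R) (vertical c).
Proof.
split; first exact: smooth_translation.
  exists (vertical (- c)); split; first exact: smooth_translation.
    by move=> p; rewrite /vertical scaleNr addrK.
  by move=> p; rewrite /vertical scaleNr subrK.
move=> p u v.
set t := c *: basis_vec R 2.
have dE w : 'd (vertical c) p w = w.
  have e := diffD (differentiable_idspace p) (differentiable_cst t p).
  have e0 := congr1 (fun F : space -> space => F w) (diff_cst t p).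
  have e1 := congr1 (fun F : space -> space => F w) e.
  exact: eq_trans e1 (eq_trans (congr2 +%R (diff_idspace p w) e0) (addr0 w)).
have px : xc (vertical c p) = xc p by have [] := verticalE c p.
have congr_metric q (a a' b b' : space) : a = a' -> b = b' ->
  nil_metric q a b = nil_metric q a' b' by move=> -> ->.
apply: eq_trans (congr_metric _ _ _ _ _ (dE u) (dE v)) _.
by rewrite /nil_metric px.
Qed.

End VerticalTranslations.

Section NilGeodesicEquation.
Variable R : realType.
Local Notation space := 'rV[R]_3.

Lemma sum_ord3 (F : 'I_3 -> R) : \sum_(i < 3) F i = F 0 + F 1 + F 2.
Proof.
rewrite !big_ord_recl big_ord0 addr0 addrA.
by congr (_ + F _ + F _); apply/val_inj.
Qed.

Lemma ord3P (P : 'I_3 -> Prop) : P 0 -> P 1 -> P 2 -> forall i, P i.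
Proof.
move=> h0 h1 h2 [[|[|[|//]]] hi]; [move: h0|move: h1|move: h2];
  by congr P; apply/val_inj.
Qed.

(* Coefficients in the order 0, 1, 2 of the metric, of its inverse and of the
   derivative of the metric with respect to the first coordinate [x]. *)
Definition nil_gram (x : R) (i j : nat) : R :=
  match i, j with
  | 0%N, 0%N => 1 | 1%N, 1%N => 1 + x ^+ 2 | 1%N, 2%N => - x | 2%N, 1%N => - x | 2%N, 2%N => 1
  | _, _ => 0
  end.

Definition nil_gram_inv (x : R) (i j : nat) : R :=
  match i, j with
  | 0%N, 0%N => 1 | 1%N, 1%N => 1 | 1%N, 2%N => x | 2%N, 1%N => x | 2%N, 2%N => 1 + x ^+ 2
  | _, _ => 0
  end.

Definition nil_dgram (x : R) (i j : nat) : R :=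
  match i, j with
  | 1%N, 1%N => 2 * x | 1%N, 2%N => - 1 | 2%N, 1%N => - 1
  | _, _ => 0
  end.

Let v0 : nat_of_ord (0 : 'I_3) = 0%N. Proof. by []. Qed.
Let v1 : nat_of_ord (1 : 'I_3) = 1%N. Proof. by []. Qed.
Let v2 : nat_of_ord (2 : 'I_3) = 2%N. Proof. by []. Qed.

Lemma nil_gramE (p : space) (i j : 'I_3) :
  gram (@nil_metric R) p i j = nil_gram (xc p) i j.
Proof.
rewrite /gram mxE /nil_metric /xc /yc /zc !mxE; move: i j.
by do 2! elim/ord3P; rewrite ?v0 ?v1 ?v2 /=; ring.
Qed.

Lemma invmx_nil_gram (p : space) (i j : 'I_3) :
  invmx (gram (@nil_metric R) p) i j = nil_gram_inv (xc p) i j.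
Proof.
pose B : 'M[R]_3 := \matrix_(i, j) nil_gram_inv (xc p) i j.
have AB : gram (@nil_metric R) p *m B = 1%:M.
  apply/matrixP => k l; rewrite [LHS]mxE sum_ord3 !nil_gramE /B !mxE; move: k l.
  by do 2! elim/ord3P; rewrite ?v0 ?v1 ?v2 /=; ring.
have [uA _] := mulmx1_unit AB.
have -> : invmx (gram (@nil_metric R) p) = B.
  by rewrite -[LHS]mulmx1 -AB mulKmx.
by rewrite mxE.
Qed.

Lemma partial_quadratic (c0 c1 c2 : R) l (p : space) :
  partial l (fun q : space => c0 + c1 * xc q + c2 * (xc q * xc q) : R) p =
  (l == 0)%:R * (c1 + 2 * c2 * xc p).
Proof.
have dx q : differentiable (fun q : space => xc q : R) q.
  exact: differentiable_coord.
have dc c q : differentiable (fun _ : space => c : R) q by exact: differentiable_cst.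
have px q : partial l (fun q : space => xc q : R) q = (l == 0)%:R.
  have -> : partial l (fun q : space => xc q : R) q = partial l id q 0 0.
    by rewrite (@partial_coord R id).
  rewrite /partial (_ : 'D_(basis_vec R l) id q = basis_vec R l); last exact: derive_id.
  by rewrite mxE /= eq_sym.
have pc c q : partial l (fun _ : space => c : R) q = 0 by exact: derive_cst.
have dM c q : differentiable (fun q : space => c * xc q : R) q.
  exact: differentiableM.
have dxx q : differentiable (fun q : space => xc q * xc q : R) q.
  exact: differentiableM.
have dM2 q : differentiable (fun q : space => c2 * (xc q * xc q) : R) q.
  exact: differentiableM.
have dD q : differentiable (fun q : space => c0 + c1 * xc q : R) q.
  exact: differentiableD.
rewrite (partialD _ (dD p) (dM2 p)) (partialD _ (dc c0 p) (dM c1 p)).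
rewrite (partialM _ (dc c1 p) (dx p)) (partialM _ (dc c2 p) (dxx p)).
by rewrite (partialM _ (dx p) (dx p)) !px !pc; ring.
Qed.

Lemma partial_nil_gram l (i j : 'I_3) (p : space) :
  partial l (fun q : space => gram (@nil_metric R) q i j : R) p =
  (l == 0)%:R * nil_dgram (xc p) i j.
Proof.
rewrite (_ : (fun q => _) = fun q : space => nil_gram 0 i j
    + nil_dgram 0 i j * xc q + 2^-1 * nil_dgram 1 i j *+ (i == j) * (xc q * xc q)).
  rewrite partial_quadratic; congr (_ * _); move: i j.
  by do 2! elim/ord3P; rewrite ?v0 ?v1 ?v2 /=; field.
apply/funext => q; rewrite nil_gramE; move: i j.
by do 2! elim/ord3P; rewrite ?v0 ?v1 ?v2 /=; field.
Qed.

Lemma nil_christoffelE (k i j : 'I_3) (p : space) :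
  christoffel (@nil_metric R) k i j p =
  2^-1 * \sum_(l < 3) nil_gram_inv (xc p) k l *
    ((i == 0)%:R * nil_dgram (xc p) j l + (j == 0)%:R * nil_dgram (xc p) i l
     - (l == 0)%:R * nil_dgram (xc p) i j).
Proof.
congr (_ * _); apply: eq_bigr => l _.
by rewrite invmx_nil_gram !partial_nil_gram.
Qed.

Lemma nil_geodesic_terms (p u : space) :
  [/\ \sum_(i < 3) \sum_(j < 3) christoffel (@nil_metric R) 0 i j p * u 0 i * u 0 j
      = yc u * (zc u - xc p * yc u),
    \sum_(i < 3) \sum_(j < 3) christoffel (@nil_metric R) 1 i j p * u 0 i * u 0 j
      = - xc u * (zc u - xc p * yc u) &
    \sum_(i < 3) \sum_(j < 3) christoffel (@nil_metric R) 2 i j p * u 0 i * u 0 j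
      = - (xc u * yc u + xc p * xc u * (zc u - xc p * yc u))].
Proof.
have [e10 e20] : (1 == 0 :> 'I_3) = false /\ (2 == 0 :> 'I_3) = false by [].
by split; rewrite !sum_ord3 !nil_christoffelE !sum_ord3 ?v0 ?v1 ?v2 ?e10 ?e20 eqxx /=
  /xc /yc /zc; field.
Qed.

End NilGeodesicEquation.

Section Derivatives.
Variable R : realType.
Implicit Types f g : R -> R.

Definition der f g : Prop := forall t : R, is_derive t 1 f (g t).

Lemma der_eq f g g' : der f g -> g =1 g' -> der f g'.
Proof. by move=> d e t; rewrite -e; apply: d. Qed.

Lemma derC (c : R) : der (fun _ => c) (fun _ => 0).
Proof. by move=> t; apply: is_derive_cst. Qed.

Lemma der_id : der (fun t => t) (fun _ => 1).
Proof. by move=> t; apply: is_derive_id. Qed.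

Lemma derD f f' g g' : der f f' -> der g g' ->
  der (fun t => f t + g t) (fun t => f' t + g' t).
Proof. by move=> df dg t; apply: (is_deriveD (df t) (dg t)). Qed.

Lemma derB f f' g g' : der f f' -> der g g' ->
  der (fun t => f t - g t) (fun t => f' t - g' t).
Proof. by move=> df dg t; apply: (is_deriveB (df t) (dg t)). Qed.

Lemma derM f f' g g' : der f f' -> der g g' ->
  der (fun t => f t * g t) (fun t => f t * g' t + g t * f' t).
Proof. by move=> df dg t; apply: (is_deriveM (df t) (dg t)). Qed.

Lemma derZ (c : R) f f' : der f f' -> der (fun t => c * f t) (fun t => c * f' t).
Proof. by move=> df t; apply: (is_deriveZ c (df t)). Qed.

Lemma der_cos f f' : der f f' -> der (fun t => cos (f t)) (fun t => - sin (f t) * f' t).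
Proof. by move=> df t; exact: (is_derive1_comp (is_derive_cos (f t)) (df t)). Qed.

Lemma der_sin f f' : der f f' -> der (fun t => sin (f t)) (fun t => cos (f t) * f' t).
Proof. by move=> df t; exact: (is_derive1_comp (is_derive_sin (f t)) (df t)). Qed.

Lemma der0_const f g : der f g -> (forall t, g t = 0) -> forall t, f t = f 0.
Proof.
by move=> d g0 t; apply: is_derive_0_is_cst => s; rewrite -(g0 s); apply: d.
Qed.

End Derivatives.

Section NilGeodesicParam.
Variable R : realType.
Local Notation space := 'rV[R]_3.

Lemma geodesic_param_der (c : R -> space) : geodesic_param (@nil_metric R) c ->
  exists U V W : R -> R,
  [/\ [/\ der (fun t => xc (c t)) U, der (fun t => yc (c t)) V &
          der (fun t => zc (c t)) W],
      [/\ der U (fun t => - (V t * (W t - xc (c t) * V t))),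
          der V (fun t => U t * (W t - xc (c t) * V t)) &
          der W (fun t => U t * V t + xc (c t) * U t * (W t - xc (c t) * V t))] &
      forall t, U t = 0 -> V t = 0 -> W t = 0 -> False].
Proof.
move=> gc.
have d1 t : derivable c t 1 by have [] := gc t.
have d2 t : derivable (derive1 c) t 1 by have [] := gc t.
have coord (h : R -> space) k : (forall t, derivable h t 1) ->
    der (fun t => h t 0 k) (fun t => derive1 h t 0 k).
  move=> dh t.
  have e : derive1 h t 0 k = 'D_1 (fun s => h s 0 k) t.
    by rewrite derive1E derive_mx ?mxE.
  by rewrite e; apply: derivableP; move: (dh t) => /derivable_mxP.
exists (fun t => xc (derive1 c t)), (fun t => yc (derive1 c t)),
  (fun t => zc (derive1 c t)).
split; first by split; apply: coord.
  have eqn k t : derive1 (derive1 c) t 0 k = - \sum_(i < 3) \sum_(j < 3)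
    christoffel (@nil_metric R) k i j (c t) * derive1 c t 0 i * derive1 c t 0 j.
    by have [_ _ _ /(_ k) /eqP] := gc t; rewrite addr_eq0 => /eqP.
  have q t := nil_geodesic_terms (c t) (derive1 c t).
  split; apply: (der_eq (coord _ _ d2)) => t; rewrite eqn; case: (q t) => q0 q1 q2.
  - by rewrite q0.
  - by rewrite q1; ring.
  - by rewrite q2; ring.
move=> t u0 v0 w0; have [_ _ /eqP nz _] := gc t; apply: nz.
by apply: space_ext; rewrite ?u0 ?v0 ?w0 /xc /yc /zc mxE.
Qed.

Lemma der_geodesic_param (c : R -> space) (U V W : R -> R) :
  der (fun t => xc (c t)) U -> der (fun t => yc (c t)) V ->
  der (fun t => zc (c t)) W ->
  der U (fun t => - (V t * (W t - xc (c t) * V t))) ->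
  der V (fun t => U t * (W t - xc (c t) * V t)) ->
  der W (fun t => U t * V t + xc (c t) * U t * (W t - xc (c t) * V t)) ->
  (forall t, U t = 0 -> V t = 0 -> W t = 0 -> False) ->
  geodesic_param (@nil_metric R) c.
Proof.
move=> dX dY dZ dU dV dW nz.
have coord (h : R -> space) (f0 f1 f2 : R -> R) :
    der (fun t => xc (h t)) f0 -> der (fun t => yc (h t)) f1 ->
    der (fun t => zc (h t)) f2 -> forall t, derivable h t 1 /\
    [/\ derive1 h t 0 0 = f0 t, derive1 h t 0 1 = f1 t & derive1 h t 0 2 = f2 t].
  move=> h0 h1 h2 t.
  have dh : derivable h t 1.
    apply/derivable_mxP => i; rewrite ord1; elim/ord3P.
    - exact: (@ex_derive _ _ _ _ _ _ _ (h0 t)).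
    - exact: (@ex_derive _ _ _ _ _ _ _ (h1 t)).
    - exact: (@ex_derive _ _ _ _ _ _ _ (h2 t)).
  split=> //; rewrite derive1E derive_mx // !mxE; split.
  - exact: (@derive_val _ _ _ _ _ _ _ (h0 t)).
  - exact: (@derive_val _ _ _ _ _ _ _ (h1 t)).
  - exact: (@derive_val _ _ _ _ _ _ _ (h2 t)).
have c1 := coord c U V W dX dY dZ.
have E0 t : xc (derive1 c t) = U t by have [_ []] := c1 t.
have E1 t : yc (derive1 c t) = V t by have [_ []] := c1 t.
have E2 t : zc (derive1 c t) = W t by have [_ []] := c1 t.
have dext (f f' g : R -> R) : f =1 f' -> der f' g -> der f g.
  by move=> /funext ->.
have c2 := coord (derive1 c) _ _ _ (dext _ _ _ E0 dU) (dext _ _ _ E1 dV)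
  (dext _ _ _ E2 dW).
move=> t; have [[dc _] [ddc [e0 e1 e2]]] := (c1 t, c2 t); split=> //.
  apply/eqP => v0; apply: (nz t); rewrite -?E0 -?E1 -?E2 v0 /xc /yc /zc mxE //.
have [q0 q1 q2] := nil_geodesic_terms (c t) (derive1 c t).
elim/ord3P.
- by rewrite q0 e0 E1 E2; ring.
- by rewrite q1 e1 E0 E1 E2; ring.
- by rewrite q2 e2 E0 E1 E2; ring.
Qed.

End NilGeodesicParam.

Section NilGeodesics.
Variable R : realType.
Local Notation space := 'rV[R]_3.
Local Notation plane := (R * R)%type.

Definition mkpt (x y z : R) : space :=
  \row_(i < 3) (if i == 0 then x else if i == 1 then y else z).

Lemma mkptE x y z :
  (xc (mkpt x y z) = x) * (yc (mkpt x y z) = y) * (zc (mkpt x y z) = z).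
Proof. by rewrite /xc /yc /zc !mxE. Qed.

(* Geodesics over the circle of centre [(a, b)] and radius [r]; for [r = 0]
   this is a fibre line. *)
Definition helix (a b r k s : R) : space :=
  mkpt (a + r * cos s) (b + r * sin s)
    (k + s * (1 + r ^+ 2 / 2) + a * (r * sin s) + r * cos s * (r * sin s) / 2).

Definition hline (x y u v k t : R) : space :=
  mkpt (x + u * t) (y + v * t) (k + x * v * t + u * v * t ^+ 2 / 2).

Lemma circle_angle (x y : R) : x ^+ 2 + y ^+ 2 = 1 ->
  exists s, x = cos s /\ y = sin s.
Proof.
move=> xy; have x1 : -1 <= x <= 1.
  by have := sqr_ge0 y; move=> y0; apply/andP; split; nra.
have cx : cos (acos x) = x by rewrite acosK// in_itv.
have sE : sin (acos x) ^+ 2 = y ^+ 2.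
  by have := cos2Dsin2 (acos x); rewrite cx; lra.
move/eqP : sE; rewrite eqf_sqr => /orP[] /eqP sE.
  by exists (acos x).
by exists (- acos x); rewrite cosN sinN sE opprK.
Qed.

Lemma polar (x y : R) : exists r s, [/\ 0 <= r, x = r * cos s & y = r * sin s].
Proof.
pose r := Num.sqrt (x ^+ 2 + y ^+ 2).
have rE : r ^+ 2 = x ^+ 2 + y ^+ 2 by rewrite sqr_sqrtr// addr_ge0 ?sqr_ge0.
have [r0|r0] := eqVneq r 0.
  exists 0, 0; rewrite !mul0r lexx; move/eqP: rE.
  rewrite r0 expr0n eq_sym /= paddr_eq0 ?sqr_ge0// !sqrf_eq0 => /andP[/eqP -> /eqP ->].
  by [].
have [|s [xs ys]] := @circle_angle (x / r) (y / r).
  by rewrite !expr_div_n -mulrDl -rE mulfV// expf_neq0.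
exists r, s; rewrite sqrtr_ge0 -xs -ys; split => //; by field.
Qed.

Lemma helix_geodesic (a b r k : R) : 0 < r ->
  geodesic (@nil_metric R) (range (helix a b r k)).
Proof.
move=> r0; exists (helix a b r k) => //.
have dc : der (fun s : R => r * cos s) (fun s => - (r * sin s)).
  by apply: der_eq (derZ r (der_cos (@der_id R))) _ => t; ring.
have ds : der (fun s : R => r * sin s) (fun s => r * cos s).
  by apply: der_eq (derZ r (der_sin (@der_id R))) _ => t; ring.
have dX : der (fun s => xc (helix a b r k s)) (fun s => - (r * sin s)).
  rewrite (_ : (fun s => _) = (fun s => a + r * cos s)); last first.
    by apply/funext => s; rewrite mkptE.
  by apply: der_eq (derD (derC a) dc) _ => t; ring.
have dY : der (fun s => yc (helix a b r k s)) (fun s => r * cos s).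
  rewrite (_ : (fun s => _) = (fun s => b + r * sin s)); last first.
    by apply/funext => s; rewrite mkptE.
  by apply: der_eq (derD (derC b) ds) _ => t; ring.
pose W s := 1 + a * (r * cos s) + r * cos s * (r * cos s).
have cs s : r ^+ 2 = (r * cos s) ^+ 2 + (r * sin s) ^+ 2.
  by rewrite !exprMn -mulrDr cos2Dsin2 mulr1.
have dZ : der (fun s => zc (helix a b r k s)) W.
  rewrite (_ : (fun s => _) = (fun s => k + (1 + r ^+ 2 / 2) * s + a * (r * sin s)
    + 2^-1 * (r * cos s * (r * sin s)))); last first.
    by apply/funext => s; rewrite mkptE; field.
  apply: der_eq (derD (derD (derD (derC k) (derZ _ (@der_id R))) (derZ a ds))
    (derZ _ (derM dc ds))) _ => t.
  by rewrite /W (cs t); field.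
have dW : der W (fun s => - (a * (r * sin s)) - 2 * (r * cos s * (r * sin s))).
  apply: der_eq (derD (derD (derC 1) (derZ a dc)) (derM dc dc)) _ => t; ring.
apply: (der_geodesic_param dX dY dZ).
- rewrite (_ : (fun s => - _) = (fun s => - 1 * (r * sin s))); last first.
    by apply/funext => s; ring.
  by apply: der_eq (derZ _ ds) _ => t; rewrite mkptE /W; ring.
- apply: der_eq dc _ => t; rewrite mkptE /W; ring.
- apply: der_eq dW _ => t; rewrite mkptE /W; ring.
- move=> t s0 c0 _; have := cs t; rewrite c0 => e.
  have := exprn_gt0 2 r0; rewrite e expr0n add0r.
  by move: s0 => /eqP; rewrite oppr_eq0 => /eqP ->; rewrite expr0n ltxx.
Qed.

Lemma hline_geodesic (x y u v k : R) : (u != 0) || (v != 0) ->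
  geodesic (@nil_metric R) (range (hline x y u v k)).
Proof.
move=> uv; exists (hline x y u v k) => //.
have did := @der_id R.
have dX : der (fun s => xc (hline x y u v k s)) (fun _ => u).
  rewrite (_ : (fun s => _) = (fun s => x + u * s)); last first.
    by apply/funext => s; rewrite mkptE.
  by apply: der_eq (derD (derC x) (derZ u did)) _ => t; ring.
have dY : der (fun s => yc (hline x y u v k s)) (fun _ => v).
  rewrite (_ : (fun s => _) = (fun s => y + v * s)); last first.
    by apply/funext => s; rewrite mkptE.
  by apply: der_eq (derD (derC y) (derZ v did)) _ => t; ring.
have dZ : der (fun s => zc (hline x y u v k s)) (fun t => x * v + u * v * t).
  rewrite (_ : (fun s => _) = (fun s => k + x * v * s + u * v / 2 * (s * s))).
    apply: der_eq (derD (derD (derC k) (derZ (x * v) did)) (derZ _ (derM did did))) _.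
    by move=> t; field.
  by apply/funext => s; rewrite mkptE; field.
have dW : der (fun t => x * v + u * v * t) (fun _ => u * v).
  by apply: der_eq (derD (derC (x * v)) (derZ (u * v) did)) _ => t; ring.
apply: (der_geodesic_param dX dY dZ).
- apply: der_eq (derC u) _ => t; rewrite mkptE; ring.
- apply: der_eq (derC v) _ => t; rewrite mkptE; ring.
- apply: der_eq dW _ => t; rewrite mkptE; ring.
- by move=> t u0 v0 _; move: uv; rewrite u0 v0 eqxx.
Qed.

(* The fibre component [W - X V] of the velocity is constant; when it is zero the
   projection is a line, otherwise the projection rotates at that angular speed. *)
Lemma nil_geodesicP (G : set space) : geodesic (@nil_metric R) G ->
  (exists a b r k, 0 <= r /\ G = range (helix a b r k)) \/
  (exists x y u v k, ((u != 0) || (v != 0)) /\ G = range (hline x y u v k)).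
Proof.
move=> [c /geodesic_param_der[U [V [W [[dX dY dZ] [dU dV dW] nz]]]] ->].
pose X t := xc (c t); pose Y t := yc (c t); pose Z t := zc (c t).
have did := @der_id R.
have wE t : W t - X t * V t = W 0 - X 0 * V 0.
  apply: (der0_const (derB dW (derM dX dV))) => s; ring.
move: wE; set k := W 0 - _ => wE.
have dU' : der U (fun t => - (V t * k)) by apply: der_eq dU _ => t; rewrite wE.
have dV' : der V (fun t => U t * k) by apply: der_eq dV _ => t; rewrite wE.
have [k0|k0] := eqVneq k 0.
  right; exists (X 0), (Y 0), (U 0), (V 0), (Z 0).
  have UE t : U t = U 0 by apply: (der0_const dU') => s; rewrite k0; ring.
  have VE t : V t = V 0 by apply: (der0_const dV') => s; rewrite k0; ring.
  have XE t : X t = X 0 + U 0 * t.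
    have e : X t - U 0 * t = X 0 - U 0 * 0.
      by apply: (der0_const (derB dX (derZ (U 0) did))) => s; rewrite UE; ring.
    lra.
  have YE t : Y t = Y 0 + V 0 * t.
    have e : Y t - V 0 * t = Y 0 - V 0 * 0.
      by apply: (der0_const (derB dY (derZ (V 0) did))) => s; rewrite VE; ring.
    lra.
  have ZE t : Z t = Z 0 + X 0 * V 0 * t + U 0 * V 0 * t ^+ 2 / 2.
    pose P s := X 0 * V 0 * s + U 0 * V 0 / 2 * (s * s).
    have e : Z t - P t = Z 0 - P 0.
      apply: (der0_const (derB dZ (derD (derZ _ did) (derZ _ (derM did did))))) => s.
      by have := wE s; rewrite k0 XE VE => /eqP; rewrite subr_eq add0r => /eqP ->; field.
    by move: e; rewrite /P => e; lra.
  split.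
    apply/negPn/negP; rewrite negb_or !negbK => /andP[/eqP u0 /eqP v0].
    by apply: (nz 0) => //; have := wE 0; rewrite v0 k0; lra.
  congr (_ @` _); apply/funext => t; apply: space_ext; rewrite mkptE.
  - exact: XE.
  - exact: YE.
  - exact: ZE.
left; pose a := X 0 - V 0 / k; pose b := Y 0 + U 0 / k.
have VE t : V t = k * (X t - a).
  have e : V t - k * X t = V 0 - k * X 0.
    by apply: (der0_const (derB dV' (derZ k dX))) => s; ring.
  by rewrite -[LHS](subrK (k * X t)) e /a; field.
have UE t : U t = - k * (Y t - b).
  have e : U t + k * Y t = U 0 + k * Y 0.
    by apply: (der0_const (derD dU' (derZ k dY))) => s; ring.
  by rewrite -[LHS](addrK (k * Y t)) e /b; field.
have dxi : der (fun t => X t - a) (fun t => - k * (Y t - b)).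
  by apply: der_eq (derB dX (derC a)) _ => t; rewrite UE subr0.
have deta : der (fun t => Y t - b) (fun t => k * (X t - a)).
  by apply: der_eq (derB dY (derC b)) _ => t; rewrite VE subr0.
have dkc := der_cos (derZ k did); have dks := der_sin (derZ k did).
have pE t : (X t - a) * cos (k * t) + (Y t - b) * sin (k * t) = X 0 - a.
  have -> : X 0 - a = (X 0 - a) * cos (k * 0) + (Y 0 - b) * sin (k * 0).
    by rewrite mulr0 cos0 sin0; ring.
  by apply: (der0_const (derD (derM dxi dkc) (derM deta dks))) => s; ring.
have qE t : (Y t - b) * cos (k * t) - (X t - a) * sin (k * t) = Y 0 - b.
  have -> : Y 0 - b = (Y 0 - b) * cos (k * 0) - (X 0 - a) * sin (k * 0).
    by rewrite mulr0 cos0 sin0; ring.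
  by apply: (der0_const (derB (derM deta dkc) (derM dxi dks))) => s; ring.
have [r [phi [r0 xr yr]]] := polar (X 0 - a) (Y 0 - b).
have xiE t : X t - a = r * cos (k * t + phi).
  rewrite cosD; transitivity ((X 0 - a) * cos (k * t) - (Y 0 - b) * sin (k * t)).
    rewrite -(pE t) -(qE t) -[LHS]mulr1 -(cos2Dsin2 (k * t)); ring.
  by rewrite xr yr; ring.
have etaE t : Y t - b = r * sin (k * t + phi).
  rewrite sinD; transitivity ((X 0 - a) * sin (k * t) + (Y 0 - b) * cos (k * t)).
    rewrite -(pE t) -(qE t) -[LHS]mulr1 -(cos2Dsin2 (k * t)); ring.
  by rewrite xr yr; ring.
have rE t : r ^+ 2 = (X t - a) ^+ 2 + (Y t - b) ^+ 2.
  by rewrite xiE etaE !exprMn -mulrDr cos2Dsin2 mulr1.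
pose F t := (k * t + phi) * (1 + r ^+ 2 / 2) + a * (Y t - b)
  + (X t - a) * (Y t - b) / 2.
exists a, b, r, (Z 0 - F 0); split=> //.
have ZE t : Z t - F t = Z 0 - F 0.
  pose F' t := (1 + r ^+ 2 / 2) * (k * t + phi) + a * (Y t - b)
    + 2^-1 * ((X t - a) * (Y t - b)).
  have FE s : F s = F' s by rewrite /F /F'; field.
  rewrite !FE.
  apply: (der0_const (derB dZ (derD (derD (derZ _ (derD (derZ k did) (derC phi)))
    (derZ a deta)) (derZ _ (derM dxi deta))))) => s.
  have -> : W s = k + X s * V s by rewrite -(wE s); ring.
  by rewrite VE (rE s); field.
have cE t : c t = helix a b r (Z 0 - F 0) (k * t + phi).
  apply: space_ext; rewrite mkptE -?xiE -?etaE.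
  - by rewrite addrC subrK.
  - by rewrite addrC subrK.
  - by rewrite -(ZE t) /F; rewrite -/(Z t); ring.
apply/seteqP; split=> p [t _ <-].
  by rewrite cE; exists (k * t + phi).
by exists ((t - phi) / k) => //; rewrite cE; congr helix; field.
Qed.

Lemma vertical_range (h h' : R -> space) (d : R) :
  (forall t, vertical d (h t) = h' t) -> vertical d @` range h = range h'.
Proof. by move=> e; rewrite image_comp; congr (_ @` _); apply/funext => t /=. Qed.

Lemma vertical_ext d (p q : space) : xc p = xc q -> yc p = yc q ->
  zc p + d = zc q -> vertical d p = q.
Proof.
by move=> ex ey ez; have [vx vy vz] := verticalE d p; apply: space_ext;
  rewrite ?vx ?vy ?vz.
Qed.

Definition over (p : plane) : set space := [set q | pr q = p].

Lemma helix_over a b r k p : intersects (range (helix a b r k)) (over p) ->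
  cyc 1 (- 2 * a) (- 2 * b) (a ^+ 2 + b ^+ 2 - r ^+ 2) p = 0.
Proof.
move=> [q [[s _ <-]]]; rewrite /over /= /pr => <-; rewrite /cyc /= !mkptE.
transitivity (r ^+ 2 * (cos s ^+ 2 + sin s ^+ 2 - 1)); first by ring.
by rewrite cos2Dsin2 subrr mulr0.
Qed.

Lemma hline_over x y u v k p : intersects (range (hline x y u v k)) (over p) ->
  cyc 0 v (- u) (u * y - v * x) p = 0.
Proof.
move=> [q [[s _ <-]]]; rewrite /over /= /pr => <-; rewrite /cyc /= !mkptE; ring.
Qed.

Lemma hline_through x y u v k (P Q : plane) : P <> Q ->
  intersects (range (hline x y u v k)) (over P) ->
  intersects (range (hline x y u v k)) (over Q) ->
  exists k', range (hline x y u v k) =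
    range (hline P.1 P.2 (Q.1 - P.1) (Q.2 - P.2) k').
Proof.
move=> PQ [p [[t1 _ <-]]] /= eP [q [[t2 _ <-]]] /= eQ.
move: eP eQ; rewrite /over /= /pr !mkptE => eP eQ.
subst P Q; rewrite /=.
have t12 : t2 - t1 != 0.
  by rewrite subr_eq0; apply/eqP => e; apply: PQ; rewrite e.
exists (k + x * v * t1 + u * v * t1 ^+ 2 / 2).
apply/seteqP; split=> z [t _ <-].
  exists ((t - t1) / (t2 - t1)) => //.
  by rewrite /hline; congr mkpt; field.
exists (t1 + (t2 - t1) * t) => //.
by rewrite /hline; congr mkpt; field.
Qed.

Lemma geodesic_three_fibres (G G' : set space) (P Q S : plane) :
  geodesic (@nil_metric R) G -> geodesic (@nil_metric R) G' ->
  P <> Q -> Q <> S -> P <> S ->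
  [/\ intersects G (over P), intersects G (over Q) & intersects G (over S)] ->
  [/\ intersects G' (over P), intersects G' (over Q) & intersects G' (over S)] ->
  equivalent (@nil_metric R) G G'.
Proof.
move=> gG gG' PQ QS PS [GP GQ GS] [GP' GQ' GS'].
suff [d e] : exists d, vertical d @` G = G'.
  by exists (vertical d) => //; apply: vertical_isometry.
have helix_line a b r x y u v : (u != 0) || (v != 0) ->
    (forall p, p = P \/ p = Q \/ p = S ->
      cyc 1 (- 2 * a) (- 2 * b) (a ^+ 2 + b ^+ 2 - r ^+ 2) p = 0 /\
      cyc 0 v (- u) (u * y - v * x) p = 0) -> False.
  move=> uv h.
  have [p1 p2] := h P (or_introl erefl).
  have [q1 q2] := h Q (or_intror (or_introl erefl)).
  have [s1 s2] := h S (or_intror (or_intror erefl)).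
  have uv' : (v != 0) || (- u != 0) by rewrite oppr_eq0 orbC.
  by have /eqP := cyc_collinear PQ QS PS uv' p1 q1 s1 p2 q2 s2; rewrite oner_eq0.
have [[a [b [r [k [r0 GE]]]]]|[x [y [u [v [k [uv GE]]]]]]] := nil_geodesicP gG;
have [[a' [b' [r' [k' [r0' GE']]]]]|[x' [y' [u' [v' [k' [uv' GE']]]]]]] :=
  nil_geodesicP gG'; subst G G'.
- have [p1 q1 s1] := And3 (helix_over GP) (helix_over GQ) (helix_over GS).
  have [p2 q2 s2] := And3 (helix_over GP') (helix_over GQ') (helix_over GS').
  pose B := 2 * (a' - a); pose C := 2 * (b' - b).
  pose D := a ^+ 2 + b ^+ 2 - r ^+ 2 - (a' ^+ 2 + b' ^+ 2 - r' ^+ 2).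
  have lE p : cyc 0 B C D p = cyc 1 (- 2 * a) (- 2 * b) (a ^+ 2 + b ^+ 2 - r ^+ 2) p
     - cyc 1 (- 2 * a') (- 2 * b') (a' ^+ 2 + b' ^+ 2 - r' ^+ 2) p.
    by rewrite /cyc /B /C /D; ring.
  have l1 : cyc 0 B C D P = 0 by rewrite lE p1 p2 subrr.
  have l2 : cyc 0 B C D Q = 0 by rewrite lE q1 q2 subrr.
  have l3 : cyc 0 B C D S = 0 by rewrite lE s1 s2 subrr.
  have [BC|] := boolP ((B != 0) || (C != 0)).
    by have /eqP := cyc_collinear PQ QS PS BC p1 q1 s1 l1 l2 l3; rewrite oner_eq0.
  rewrite negb_or !negbK => /andP[/eqP B0 /eqP C0].
  have aa' : a' = a by move: B0; rewrite /B; lra.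
  have bb' : b' = b by move: C0; rewrite /C; lra.
  subst a' b'.
  have /eqP : r' ^+ 2 = r ^+ 2 by move: p1 p2; rewrite /cyc; lra.
  rewrite eqrXn2 // => /eqP ->.
  exists (k' - k); apply: vertical_range => t.
  by apply: vertical_ext; rewrite !mkptE //; ring.
- exfalso; apply: (helix_line a b r x' y' u' v' uv') => p [->|[->|->]]; split;
    solve [exact: helix_over GP|exact: helix_over GQ|exact: helix_over GS|
      exact: hline_over GP'|exact: hline_over GQ'|exact: hline_over GS'].
- exfalso; apply: (helix_line a' b' r' x y u v uv) => p [->|[->|->]]; split;
    solve [exact: helix_over GP'|exact: helix_over GQ'|exact: helix_over GS'|
      exact: hline_over GP|exact: hline_over GQ|exact: hline_over GS].
- have [l ->] := hline_through PQ GP GQ; have [l' ->] := hline_through PQ GP' GQ'.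
  exists (l' - l); apply: vertical_range => t.
  by apply: vertical_ext; rewrite !mkptE //; ring.
Qed.

Lemma cycle_geodesic (f : plane -> R) P Q : cycle f -> (exists p, f p != 0) ->
  P <> Q -> f P = 0 -> f Q = 0 -> exists G, geodesic (@nil_metric R) G /\
    forall p, f p = 0 -> intersects G (over p).
Proof.
move=> cf nf PQ fP fQ.
have [[a [b [r [r0 fE]]]]|[a [b [d [ab fE]]]]] := cycle_zero_set cf nf PQ fP fQ.
  exists (range (helix a b r 0)); split; first exact: helix_geodesic.
  move=> [x y] /fE /= e; have rn : r != 0 by rewrite gt_eqF.
  have [|s [xs ys]] := @circle_angle ((x - a) / r) ((y - b) / r).
    by rewrite !expr_div_n -mulrDl e mulfV// expf_neq0.
  exists (helix a b r 0 s); split; first by exists s.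
  by rewrite /over /= /pr !mkptE -xs -ys; congr pair; field.
have ba : (- b != 0) || (a != 0).
  by rewrite oppr_eq0 orbC; apply/orP.
exists (range (hline P.1 P.2 (- b) a 0)); split; first exact: hline_geodesic.
move=> [x y] /fE /= e; move/fE : fP => eP.
have n0 : a ^+ 2 + b ^+ 2 != 0.
  by have := sum_sqr_gt0 ba; rewrite sqrrN addrC => /lt0r_neq0.
pose t := (a * (y - P.2) - b * (x - P.1)) / (a ^+ 2 + b ^+ 2).
have l : a * (x - P.1) + b * (y - P.2) = 0 by move: e eP => <-; lra.
exists (hline P.1 P.2 (- b) a 0 t); split; first by exists t.
rewrite /over /= /pr !mkptE /t; congr pair.
  transitivity (x - a * (a * (x - P.1) + b * (y - P.2)) / (a ^+ 2 + b ^+ 2)).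
    by field.
  by rewrite l; ring.
transitivity (y - b * (a * (x - P.1) + b * (y - P.2)) / (a ^+ 2 + b ^+ 2)).
  by field.
by rewrite l; ring.
Qed.

End NilGeodesics.

Theorem theorem3p9 (R : realType)
    (A1 A2 A3 B1 B2 B3 A1' A2' A3' B1' B2' B3' : 'rV[R]_3)
    (m1 m2 m3 m1' m2' m3' : set 'rV[R]_3) :
  pappus_configuration A1 A2 A3 B1 B2 B3 A1' A2' A3' B1' B2' B3'
    m1 m2 m3 m1' m2' m3' ->
  exists! C : set (set 'rV[R]_3),
    geodesic_class (@nil_metric R) C /\
    exists G : set 'rV[R]_3,
      [/\ C G,
          [/\ intersects G m1, intersects G m2 & intersects G m3] &
          [/\ intersects G m1', intersects G m2' & intersects G m3']].
Proof.
move=> /pappus_fibres[M [P1 [Q1 [P2 [Q2 [P3 [Q3 [S]]]]]]]].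
move=> [[-> ->] [-> ->] [-> ->] [cM nM [MP1 MQ1] [MP2 MQ2] [MP3 MQ3]]].
move=> [PQ1 hS SP1 SQ1].
have [G [gG GM]] := cycle_geodesic cM nM PQ1 MP1 MQ1.
have three H : [/\ intersects H (over P1), intersects H (over P2) &
      intersects H (over P3)] ->
    [/\ intersects H (over Q1), intersects H (over Q2) & intersects H (over Q3)] ->
    [/\ intersects H (over P1), intersects H (over Q1) & intersects H (over S)].
  by move=> [p1 p2 p3] [q1 q2 q3]; split=> //; case: hS => ->.
have GP : [/\ intersects G (over P1), intersects G (over P2) &
    intersects G (over P3)] by split; apply: GM.
have GQ : [/\ intersects G (over Q1), intersects G (over Q2) &
    intersects G (over Q3)] by split; apply: GM.
exists [set H | geodesic (@nil_metric R) H /\ equivalent (@nil_metric R) G H].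
split.
  split; first by exists G.
  exists G; split; [|exact: GP|exact: GQ].
  by split=> //; apply: equivalent_refl.
move=> C [gC [H [CH HP HQ]]]; apply/esym; apply: (geodesic_class_eq gC CH).
have gH : geodesic (@nil_metric R) H by case: gC CH => G0 _ -> [].
apply: (geodesic_three_fibres gG gH PQ1 _ _ (three G GP GQ) (three H HP HQ)).
  exact: not_eq_sym.
exact: not_eq_sym.
Qed.
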